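(* There exist numerical constants $c_1,c_2,c_3>0$ such that the following holds in the Gaussian $G$-latent setting below. Let $\widehat\Gamma$ be any diagonal matrix-valued estimator (a measurable function of $\mathbf{X}$) and $\delta_{n,p}\ge0$ such that $|\widehat\Gamma-\Gamma|_V\le\delta_{n,p}$ with probability at least $1-c_3/(2p)$. Assume $\log(p)\le c_1n$ and $$\Delta(C)\ge c_2\Big[|\Gamma|_\infty\Big\{\sqrt{\tfrac{\log p}{mn}}+\sqrt{\tfrac{p}{nm^2}}+\tfrac{\log p}{n}+\tfrac{p}{nm}\Big\}+\tfrac{\delta_{n,p}}{m}\Big].$$ Then with probability at least $1-c_3/p$, $B^*$ is the unique maximizer of $B\mapsto\langle\widehat\Sigma-\widehat\Gamma,B\rangle$ over $\mathcal{C}$.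
   Context: Setting: $G=\{G_1,\dots,G_K\}$ is a partition of $[p]$ into nonempty groups, $k(a)$ the index with $a\in G_{k(a)}$, $m=\min_k|G_k|$. $X$ satisfies $X_a=Z_{k(a)}+E_a$, with $Z\sim N(0,C)$ in $\mathbb{R}^K$ and $E\sim N(0,\Gamma)$ in $\mathbb{R}^p$ independent, $\Gamma$ diagonal with $\Gamma_{aa}=\gamma_{k(a)}>0$; so $X\sim N(0,\Sigma)$, $\Sigma=ACA^t+\Gamma$, $A_{ak}=1_{\{a\in G_k\}}$. The data are $n$ i.i.d. copies of $X$ stacked as rows of the $n\times p$ matrix $\mathbf{X}$; $\widehat\Sigma=\mathbf{X}^t\mathbf{X}/n$. $\Delta(C)=\min_{j<k}(C_{jj}+C_{kk}-2C_{jk})$. For diagonal $D$, $|D|_V=\max_aD_{aa}-\min_aD_{aa}$; $|M|_\infty$ is the largest absolute entry. $B^*_{ab}=1/|G_k|$ if $a,b\in G_k$, else $0$. $\langle M,N\rangle=\mathrm{tr}(M^tN)$. $\mathcal{C}$ is the set of symmetric positive semidefinite $p\times p$ matrices $B$ with $\sum_aB_{ab}=1$ for all $b$, $B_{ab}\ge0$, and $\mathrm{tr}(B)=K$. *)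

(* Defs.v *)
From HB Require Import structures.
From mathcomp Require Import all_boot all_order all_algebra.
From mathcomp Require Import all_classical all_reals all_analysis.
From mathcomp Require Import normal_distribution.
Set Implicit Arguments. Unset Strict Implicit. Unset Printing Implicit Defensive.
Import Order.TTheory GRing.Theory Num.Theory.
Local Open Scope classical_set_scope.
Local Open Scope ring_scope.

Section Defs.
Context {R : realType}.

Definition centered_normal_law d (T : measurableType d) (P : probability T R)
    (Y : T -> R) (v : R) : Prop :=
  measurable_fun setT Y /\
  forall A : set R, measurable A ->
    P (Y @^-1` A) =
      (if v == 0 then (\1_A (0 : R))%:E else normal_prob 0 (Num.sqrt v) A).

Definition gauss_vec d (T : measurableType d) (P : probability T R)
    (I : finType) (Y : I -> T -> R) (S : I -> I -> R) : Prop :=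
  forall u : I -> R,
    centered_normal_law P (fun w => \sum_(i : I) u i * Y i w)
      (\sum_(i : I) \sum_(j : I) u i * u j * S i j).

(* Mutual independence of the random vectors (Y i)_{i : g i = j}, j : J
   (product rule on all measurable rectangles). *)
Definition indep_groups d (T : measurableType d) (P : probability T R)
    (I J : finType) (g : I -> J) (Y : I -> T -> R) : Prop :=
  forall A : I -> set R, (forall i, measurable (A i)) ->
    P (\bigcap_(i in [set: I]) (Y i @^-1` A i)) =
    (\big[*%E/1%E]_(j : J) P (\bigcap_(i in [set i | g i = j]) (Y i @^-1` A i)))%E.

(* The G-latent model: grp a = k(a); rows i = 1..n are i.i.d. copies;
   Z i ~ N(0,C), E i ~ N(0,Gamma) all mutually independent. *)
Definition latent_index n K p := ('I_n * ('I_K + 'I_p))%type.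

Definition latent_var n K p d (T : measurableType d)
    (Z : 'I_n -> 'I_K -> T -> R) (E : 'I_n -> 'I_p -> T -> R)
    (x : latent_index n K p) : T -> R :=
  match x.2 with inl k => Z x.1 k | inr a => E x.1 a end.

Definition latent_group n K p (x : latent_index n K p) : ('I_n * bool)%type :=
  (x.1, match x.2 with inl _ => false | inr _ => true end).

Definition Gamma_of p K (grp : 'I_p -> 'I_K) (gam : 'I_K -> R) : 'M[R]_p :=
  \matrix_(a, b) (if a == b then gam (grp a) else 0).

Definition GLatentModel d (T : measurableType d) (P : probability T R)
    (n p K : nat) (grp : 'I_p -> 'I_K) (C : 'M[R]_K) (gam : 'I_K -> R)
    (Z : 'I_n -> 'I_K -> T -> R) (E : 'I_n -> 'I_p -> T -> R) : Prop :=
  [/\ forall i k, measurable_fun setT (Z i k),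
      forall i a, measurable_fun setT (E i a),
      indep_groups P (@latent_group n K p) (latent_var Z E),
      forall i, gauss_vec P (Z i) (fun k l => C k l)
    & forall i, gauss_vec P (E i) (fun a b => Gamma_of grp gam a b)].

Definition Xdata n p K d (T : measurableType d) (grp : 'I_p -> 'I_K)
    (Z : 'I_n -> 'I_K -> T -> R) (E : 'I_n -> 'I_p -> T -> R) (w : T)
  : 'M[R]_(n, p) := \matrix_(i, a) (Z i (grp a) w + E i a w).

Definition Sigmahat n p (X : 'M[R]_(n, p)) : 'M[R]_p :=
  (n%:R)^-1 *: (X^T *m X).

Definition group_size p K (grp : 'I_p -> 'I_K) (k : 'I_K) : nat :=
  #|[set a | grp a == k]|.

Definition min_group_size p K (grp : 'I_p -> 'I_K) : nat :=
  \big[minn/p]_(k < K) group_size grp k.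

Definition Bstar p K (grp : 'I_p -> 'I_K) : 'M[R]_p :=
  \matrix_(a, b) (if grp a == grp b then (group_size grp (grp a))%:R^-1 else 0).

Definition supnorm m n (M : 'M[R]_(m, n)) : R :=
  \big[Num.max/0]_(i < m) \big[Num.max/0]_(j < n) `|M i j|.

(* |D|_V = max_a D_aa - min_a D_aa  (= max_{a,b} (D_aa - D_bb)) *)
Definition varnorm p (D : 'M[R]_p) : R :=
  \big[Num.max/0]_(a < p) \big[Num.max/0]_(b < p) (D a a - D b b).

Definition inner p (M N : 'M[R]_p) : R := \tr (M^T *m N).

Definition psd p (B : 'M[R]_p) : Prop :=
  forall v : 'cV[R]_p, 0 <= (v^T *m B *m v) 0 0.

Definition Cset p (K : nat) (B : 'M[R]_p) : Prop :=
  [/\ B^T = B, psd B, (forall b, \sum_(a < p) B a b = 1),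
      (forall a b, 0 <= B a b) & \tr B = K%:R].

Definition unique_maximizer p K (M B0 : 'M[R]_p) : Prop :=
  Cset K B0 /\ forall B, Cset K B -> B <> B0 -> inner M B < inner M B0.

End Defs.

(* Main.v *)
Require Import Defs.
From HB Require Import structures.
From mathcomp Require Import all_boot all_order all_algebra.
From mathcomp Require Import all_classical all_reals all_analysis.
From mathcomp Require Import measurable_realfun normal_distribution ring lra zify.
Set Implicit Arguments. Unset Strict Implicit. Unset Printing Implicit Defensive.
Import Order.TTheory GRing.Theory Num.Theory.
Local Open Scope classical_set_scope.
Local Open Scope ring_scope.

(** Write X = Z A^t + E row by row, P = B^* and H = P - B.  Since the columns of
    H sum to 0, the signal part of <Sigmahat - Ghat, H> is half the sum, over
    pairs a, b in different groups, of B_ab times the empirical second moment of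
    Z_k(a) - Z_k(b), and the cross terms are handled in the same way.  The
    remaining noise matrix N is paired with
      H = P H + H P - P H P - (1 - P) B (1 - P):
    the first three terms cost the largest entry of P N times the mass of B
    outside the diagonal blocks, the last one the largest eigenvalue of N times
    tr (P H), which is at most that mass divided by m.  By polarization every
    random quantity is a sum over the rows of squares of Gaussian variables, or
    of products of two independent ones, so Chernoff bounds and a union bound
    apply; for the eigenvalue the union runs over the at most 64^p integer
    points of the ball of radius 2 sqrt p. *)

(** * Positive semidefinite matrices and the set C *)

Section Gram.
Context {R : realType}.

(** The gain in m has two sources. Averaging over a group divides a noise entry by about sqrt m,
    which yields the rate sqrt (log p / (m n)); and tr (P H) carries the factor 1/m of the spectral
    rates. As tr H = 0, a multiple of the identity is invisible to the comparison, so the diagonal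
    estimator matters only through |.|_V. The sign of the last term of the decomposition matters
    too: (1 - P) B (1 - P) is positive semidefinite, so an upper bound on the quadratic form of N
    suffices, and finitely many integer points control it at the price of a lower bound on the
    diagonal of N. The signal is controlled relative to its own variance, whatever the size of C,
    and the cross term through the geometric mean of that variance and gamma, which the separation
    hypothesis turns into a small fraction of the signal. *)

Definition qf p (N : 'M[R]_p) (v : 'I_p -> R) : R :=
  \sum_a \sum_b N a b * (v a * v b).

Lemma innerE p (M N : 'M[R]_p) : inner M N = \sum_a \sum_b M a b * N a b.
Proof.
rewrite /inner /mxtrace exchange_big /=; apply: eq_bigr => b _.
by rewrite mxE; apply: eq_bigr => a _; rewrite mxE.
Qed.

Lemma qfE p (N : 'M[R]_p) (v : 'cV[R]_p) :
  (v^T *m N *m v) 0 0 = qf N (fun a => v a 0).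
Proof.
rewrite mxE /qf exchange_big /=; apply: eq_bigr => b _.
rewrite mxE big_distrl /=; apply: eq_bigr => a _.
by rewrite mxE; ring.
Qed.

Lemma psd_qf p (N : 'M[R]_p) v : psd N -> 0 <= qf N v.
Proof.
move=> /(_ (\col_a v a)); rewrite qfE.
by under eq_fun do rewrite mxE.
Qed.

(** An exact Taylor expansion in one coordinate. It gives the pivot inequality of the Gram
    decomposition, the rounding step on integer points and the polarization of [probe]. *)
Lemma qf_add_delta p (N : 'M[R]_p) (v : 'I_p -> R) (a : 'I_p) (t : R) :
  (forall a b, N a b = N b a) ->
  qf N (fun b => v b + (if b == a then t else 0)) =
  qf N v + 2 * t * (\sum_b N a b * v b) + t ^+ 2 * N a a.
Proof.
move=> sN; pose d b : R := if b == a then t else 0.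
have sd (F : 'I_p -> R) : \sum_b F b * d b = t * F a.
  rewrite (bigD1 a) //= {1}/d eqxx big1 ?addr0 1?mulrC // => b ba.
  by rewrite /d (negbTE ba) mulr0.
have -> : qf N (fun b => v b + d b) =
    qf N v + \sum_b (\sum_c N b c * v c) * d b
    + \sum_b \sum_c (N b c * v b) * d c + \sum_b \sum_c (N b c * d b) * d c.
  under [X in _ = _ + X + _ + _]eq_bigr do rewrite big_distrl.
  rewrite /qf -!big_split; apply: eq_bigr => b _ /=.
  by rewrite -!big_split; apply: eq_bigr => c _ /=; ring.
rewrite sd; under [X in _ + _ + X + _]eq_bigr do rewrite sd sN.
under [X in _ + X]eq_bigr do rewrite sd.
by rewrite -!big_distrr sd /=; ring.
Qed.

Lemma qf_delta p (N : 'M[R]_p) (a : 'I_p) :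
  qf N (fun b => if b == a then 1 else 0) = N a a.
Proof.
rewrite /qf (bigD1 a) //= [X in _ + X]big1 => [|b /negbTE ->]; last first.
  by rewrite big1 // => c _; rewrite mul0r mulr0.
rewrite (bigD1 a) //= [X in _ + X + _]big1 => [|b /negbTE ->]; last first.
  by rewrite !mulr0.
by rewrite eqxx !mulr1 !addr0.
Qed.

(** Elimination by pivots: at a nonzero diagonal entry a, subtracting v v^t with v the row a of B
    divided by sqrt (B a a) leaves a Schur complement that is again positive semidefinite and has
    fewer nonzero diagonal entries, which drives the induction. *)
Lemma gram_decomposition p (B : 'M[R]_p) :
  (forall a b, B a b = B b a) -> (forall v, 0 <= qf B v) ->
  exists n (V : 'I_n -> 'I_p -> R), forall a b, B a b = \sum_(i < n) V i a * V i b.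
Proof.
move=> sB pB; have [n] := ubnP #|[pred a | B a a != 0]|.
elim: n => // n IHn in B sB pB *.
have diag a : 0 <= B a a.
  by have := pB (fun b => if b == a then 1 else 0); rewrite qf_delta.
have CS (v : 'I_p -> R) a t :
    0 <= qf B v + 2 * t * (\sum_b B a b * v b) + t ^+ 2 * B a a.
  by rewrite -qf_add_delta.
have [/existsP[a Ba0] | /existsPn B0] := boolP [exists a, B a a != 0].
- move=> cardB; have Ba : 0 < B a a by rewrite lt_neqAle eq_sym Ba0 diag.
  pose v b := B a b / Num.sqrt (B a a).
  have vv b c : v b * v c = B a b * B a c / B a a.
    rewrite /v mulrACA -invfM -expr2 sqr_sqrtr //; exact: ltW.
  pose B' : 'M[R]_p := \matrix_(b, c) (B b c - v b * v c).
  have sB' b c : B' b c = B' c b by rewrite !mxE sB (mulrC (v b)).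
  have pB' w : 0 <= qf B' w.
    have -> : qf B' w = qf B w - (\sum_b B a b * w b) ^+ 2 / B a a.
      rewrite /qf expr2 big_distrl /= big_distrl /= -sumrB; apply: eq_bigr => b _.
      rewrite big_distrr big_distrl /= -sumrB; apply: eq_bigr => c _.
      by rewrite mxE vv; field.
    (* This t minimizes the form along coordinate a, and the minimum is [qf B' w]. *)
    have := CS w a (- (\sum_b B a b * w b) / B a a).
    congr (0 <= _); field; exact: Ba0.
  (* Zero diagonal entries stay zero, since the complement lowers the diagonal and keeps it
     nonnegative; entry a joins them. *)
  have dB' b : B b b == 0 -> B' b b == 0.
    move=> /eqP Bb; rewrite eq_le; apply/andP; split.
      by rewrite mxE Bb sub0r oppr_le0 -expr2 sqr_ge0.
    by have := pB' (fun c => if c == b then 1 else 0); rewrite qf_delta.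
  have [|m [V HV]] := IHn B' sB' pB'.
    rewrite -ltnS; apply: leq_trans cardB; rewrite ltnS.
    apply: proper_card; apply/properP; split.
      by apply/fintype.subsetP => b; rewrite !inE; apply: contraNN => /dB'.
    exists a; rewrite !inE ?negbK //= mxE vv; apply/eqP; field; exact: Ba0.
  exists m.+1, (fun i => if unlift ord0 i is Some j then V j else v) => b c.
  rewrite big_ord_recl unlift_none; under eq_bigr do rewrite liftK.
  by rewrite -HV mxE addrC subrK.
(* All diagonal entries vanish, so what remains of the form is linear in t, and the two signs of t
   force [B a b] = 0. *)
- move=> _; exists 0%N, (fun _ _ => 0) => a b; rewrite big_ord0.
  have Bd c : B c c = 0 by apply/eqP; move: (B0 c); rewrite negbK.
  have C2 t : 0 <= 2 * t * B a b.
    have := CS (fun c => if c == b then 1 else 0) a t.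
    rewrite qf_delta !Bd mulr0 addr0 add0r (bigD1 b) //= eqxx mulr1.
    by rewrite big1 ?addr0 // => c /negbTE ->; rewrite mulr0.
  have := C2 1; have := C2 (-1); lra.
Qed.

End Gram.

(** * The averaging projection [Bstar] and its comparison with a point of C *)

Section Partition.
Context {R : realType} {p K : nat} (grp : 'I_p -> 'I_K).
Notation P := (Bstar grp : 'M[R]_p).

Lemma group_sizeE k : group_size grp k = #|[pred a | grp a == k]|.
Proof. by apply: eq_card => a; rewrite [RHS]inE; apply/idP/idP => [/set_mem|/mem_set]. Qed.

Lemma group_size_gt0 a : (0 < group_size grp (grp a))%N.
Proof. by rewrite group_sizeE; apply/card_gt0P; exists a; rewrite inE. Qed.

Lemma BstarC a b : P a b = P b a.
Proof. by rewrite !mxE eq_sym; case: eqP => // ->. Qed.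

Lemma Bstar_ge0 a b : 0 <= P a b.
Proof. by rewrite mxE; case: ifP => // _; rewrite invr_ge0 ler0n. Qed.

Lemma Bstar_block0 a b : grp a != grp b -> P a b = 0.
Proof. by rewrite mxE => /negbTE ->. Qed.

Lemma sum_group_cst k (x : R) :
  \sum_(a | grp a == k) x = x * (group_size grp k)%:R.
Proof. by rewrite sumr_const mulr_natr group_sizeE. Qed.

Lemma Bstar_mean a (F : 'I_p -> R) :
  \sum_c P a c * F c =
  (group_size grp (grp a))%:R^-1 * \sum_(c | grp c == grp a) F c.
Proof.
rewrite (bigID (fun c => grp c == grp a)) /= [X in _ + X]big1 ?addr0.
  rewrite big_distrr /=; apply: eq_bigr => c /eqP ca.
  by rewrite mxE ca eqxx.
by move=> c ca; rewrite Bstar_block0 ?mul0r // eq_sym.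
Qed.

Lemma Bstar_rowsum a : \sum_c P a c = 1.
Proof.
under eq_bigr do rewrite -[P _ _]mulr1.
rewrite Bstar_mean sum_group_cst mul1r mulVf //.
by rewrite pnatr_eq0 -lt0n group_size_gt0.
Qed.

Lemma Bstar_colsum b : \sum_a P a b = 1.
Proof. by under eq_bigr do rewrite BstarC; exact: Bstar_rowsum. Qed.

Lemma Bstar_tr : P^T = P.
Proof. by apply/matrixP => a b; rewrite mxE BstarC. Qed.

Lemma Bstar_eq a b c : grp b = grp c -> P a b = P a c.
Proof. by rewrite !mxE => ->. Qed.

Lemma Bstar_idem : P *m P = P.
Proof.
apply/matrixP => a b; rewrite mxE Bstar_mean.
rewrite (eq_bigr (fun=> P a b)) => [|c /eqP ca]; last first.
  by rewrite (BstarC c b) (BstarC a b); exact: Bstar_eq.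
rewrite sum_group_cst mulrCA mulVf ?mulr1 //.
by rewrite pnatr_eq0 -lt0n group_size_gt0.
Qed.

Lemma Bstar_psd : psd P.
Proof.
move=> v; rewrite -Bstar_idem -{1}Bstar_tr mulmxA -trmx_mul -mulmxA mxE.
by apply: sumr_ge0 => a _; rewrite mxE -expr2 sqr_ge0.
Qed.

Lemma Bstar_trace : (forall k : 'I_K, exists a : 'I_p, grp a = k) ->
  \tr P = K%:R.
Proof.
move=> surj; rewrite /mxtrace (partition_big grp predT) //=.
rewrite (eq_bigr (fun=> 1)) ?sumr_const ?card_ord // => k _.
have [a <-] := surj k.
rewrite (eq_bigr (fun c => P a c * 1)) => [|c /eqP ca]; last first.
  by rewrite !mxE ca !eqxx mulr1.
transitivity (\sum_c P a c); last exact: Bstar_rowsum.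
rewrite [RHS](bigID (fun c => grp c == grp a)) /= [X in _ + X]big1 ?addr0.
  by apply: eq_bigr => c _; rewrite mulr1.
by move=> c ca; rewrite Bstar_block0 // eq_sym.
Qed.

Lemma Bstar_Cset : (forall k : 'I_K, exists a : 'I_p, grp a = k) -> Cset K P.
Proof.
move=> surj; split.
- exact: Bstar_tr.
- exact: Bstar_psd.
- exact: Bstar_colsum.
- exact: Bstar_ge0.
- exact: Bstar_trace.
Qed.

Section Comparison.
Variable B : 'M[R]_p.
Hypothesis surj : forall k : 'I_K, exists a : 'I_p, grp a = k.
Hypothesis BC : Cset K B.

(** Common unit of the comparison: signal gains and noise costs are both expressed through these
    entries, and the mass vanishes only at [Bstar]. *)
Definition offmass : R := \sum_b \sum_(c | grp c != grp b) B c b.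

Let H := P - B.
Let Bsym a b : B a b = B b a.
Proof. by case: BC => trB _ _ _ _; rewrite -{1}trB mxE. Qed.
Let Bcol b : \sum_a B a b = 1. Proof. by case: BC. Qed.
Let B0 a b : 0 <= B a b. Proof. by case: BC. Qed.
Let HE a b : H a b = P a b - B a b.
Proof. by rewrite /H mxE [(- B) a b]mxE. Qed.
Let Hcol b : \sum_a H a b = 0.
Proof. by under eq_bigr do rewrite HE; rewrite sumrB Bcol Bstar_colsum subrr. Qed.
Let Hsym a b : H a b = H b a. Proof. by rewrite !HE BstarC Bsym. Qed.
Let Hrow a : \sum_b H a b = 0.
Proof. by under eq_bigr do rewrite Hsym. Qed.

Lemma offmass_ge0 : 0 <= offmass.
Proof. by apply: sumr_ge0 => b _; apply: sumr_ge0. Qed.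

Let Sb b := \sum_(c | grp c != grp b) B c b.
Let Sb0 b : 0 <= Sb b. Proof. exact: sumr_ge0. Qed.

(** Within the group of b the entries [P a c] all equal [P a b]. As column b of H sums to 0, its sum
    over that group is minus the sum outside, where H = - B. *)
Lemma Bstar_mulH a b :
  (P *m H) a b = P a b * Sb b - \sum_(c | grp c != grp b) P a c * B c b.
Proof.
rewrite mxE (bigID (fun c => grp c == grp b)) /=; congr (_ + _); last first.
  rewrite -sumrN; apply: eq_bigr => c cb.
  by rewrite HE (Bstar_block0 cb) sub0r mulrN.
rewrite (eq_bigr (fun c => P a b * H c b)) => [|c /eqP cb]; last first.
  by rewrite (Bstar_eq _ cb).
rewrite -big_distrr /=; congr (_ * _).
have := Hcol b; rewrite (bigID (fun c => grp c == grp b)) /=.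
move/eqP; rewrite addr_eq0 => /eqP ->; rewrite -sumrN.
by apply: eq_bigr => c cb; rewrite HE (Bstar_block0 cb) sub0r opprK.
Qed.

Lemma norm1_Bstar_mulH : \sum_b \sum_a `|(P *m H) a b| <= 2 * offmass.
Proof.
rewrite /offmass big_distrr /=; apply: ler_sum => b _.
pose V a := \sum_(c | grp c != grp b) P a c * B c b.
have V0 a : 0 <= V a.
  by apply: sumr_ge0 => c _; apply: mulr_ge0 => //; exact: Bstar_ge0.
apply: (@le_trans _ _ (\sum_a (P a b * Sb b + V a))).
  apply: ler_sum => a _; rewrite Bstar_mulH.
  apply: le_trans (ler_normB _ _) _; rewrite (ger0_norm (V0 a)) ger0_norm //.
  by apply: mulr_ge0 => //; exact: Bstar_ge0.
rewrite big_split /= -big_distrl /= Bstar_colsum mul1r /V exchange_big /=.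
under [X in _ + X]eq_bigr do rewrite -big_distrl /= Bstar_colsum mul1r.
by rewrite -/(Sb b); lra.
Qed.

(** On the diagonal the second term of [Bstar_mulH] vanishes, and [P b b] is the inverse of a group
    size. *)
Lemma trace_Bstar_mulH (m : R) : 0 < m ->
  (forall k, m <= (group_size grp k)%:R) -> \tr (P *m H) <= offmass / m.
Proof.
move=> m0 hm; rewrite /mxtrace /offmass big_distrl /=; apply: ler_sum => b _.
rewrite Bstar_mulH [X in _ - X]big1 => [|c cb]; last first.
  by rewrite Bstar_block0 ?mul0r // eq_sym.
rewrite subr0 mulrC ler_wpM2l //.
rewrite mxE eqxx lef_pV2 ?posrE // ?hm // ltr0n; exact: group_size_gt0.
Qed.

Section Noise.
Variables (N : 'M[R]_p) (eta lam m : R).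
Hypothesis m0 : 0 < m.
Hypothesis hm : forall k, m <= (group_size grp k)%:R.
Hypothesis Nsym : forall a b, N a b = N b a.
Hypothesis PN : forall a b, `|(P *m N) a b| <= eta.
Hypothesis lam0 : 0 <= lam.
Hypothesis qfN : forall v, qf N v <= lam * \sum_a v a ^+ 2.

Let Q : 'M[R]_p := 1%:M - P.

(** (1 - P) P = 0 turns (1 - P) H (1 - P) into - (1 - P) B (1 - P), a negative semidefinite matrix;
    this is why [qfN] bounds N from one side only. *)
Lemma comparison_decomposition :
  H = P *m H + H *m P - P *m H *m P - Q *m B *m Q.
Proof.
have PQ : P *m Q = 0 by rewrite mulmxBr mulmx1 Bstar_idem subrr.
have -> : Q *m B *m Q = - (Q *m H *m Q).
  have QPQ : Q *m P *m Q = 0 by rewrite -mulmxA PQ mulmx0.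
  have -> : Q *m H = Q *m P - Q *m B by exact: mulmxBr.
  by rewrite (mulmxBl (Q *m P)) QPQ sub0r opprK.
rewrite /Q; move: (H) => X; rewrite !(mulmxBl, mulmxBr) !mulmx1 !mul1mx.
by apply/matrixP => a b; rewrite !mxE; lra.
Qed.

Lemma inner_le_norm1 (M U : 'M[R]_p) (e s : R) : 0 <= e ->
  (forall a b, `|M a b| <= e) -> \sum_b \sum_a `|U a b| <= s ->
  `|inner M U| <= e * s.
Proof.
move=> e0 hM hU; rewrite innerE (le_trans (ler_norm_sum _ _ _)) //.
apply: le_trans (ler_wpM2l e0 hU); rewrite exchange_big big_distrr /=.
apply: ler_sum => a _; rewrite (le_trans (ler_norm_sum _ _ _)) //.
rewrite big_distrr; apply: ler_sum => b _ /=.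
by rewrite normrM ler_wpM2r.
Qed.

Let tN : N^T = N. Proof. by apply/matrixP => a b; rewrite mxE Nsym. Qed.
Let tH : H^T = H. Proof. by apply/matrixP => a b; rewrite mxE Hsym. Qed.

Let eta0 : (0 < p)%N -> 0 <= eta.
Proof. by move=> p0; apply: le_trans (PN (Ordinal p0) (Ordinal p0)). Qed.

(** Factor B as the sum of the V_i V_i^t and project: W_i = (1 - P) V_i. Since tr B = K = tr P, the
    trace of (1 - P) B (1 - P) is tr P - tr (P B) = tr (P H). The last clause serves the uniqueness
    of the maximizer. *)
Lemma centered_gram : exists n (W : 'I_n -> 'I_p -> R),
  [/\ forall a b, (Q *m B *m Q) a b = \sum_(i < n) W i a * W i b,
      \sum_(i < n) \sum_a W i a ^+ 2 = \tr (P *m H) &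
      (forall i a, W i a = 0) -> P *m B = B].
Proof.
have [n [V HV]] := gram_decomposition Bsym
  (fun v => psd_qf v (let: And5 _ h _ _ _ := BC in h)).
have tQ : Q^T = Q by rewrite /Q linearB /= trmx1 Bstar_tr.
have QQ : Q *m Q = Q.
  by rewrite {1}/Q mulmxBl mul1mx mulmxBr mulmx1 Bstar_idem subrr subr0.
have Qs a b : Q a b = Q b a by rewrite -{1}tQ mxE.
pose W i a := \sum_c Q a c * V i c.
have HW a b : (Q *m B *m Q) a b = \sum_(i < n) W i a * W i b.
  rewrite mxE; under eq_bigr do rewrite mxE big_distrl /=.
  under [RHS]eq_bigr do rewrite /W big_distrl /=.
  rewrite [RHS]exchange_big /= exchange_big /=; apply: eq_bigr => c _.
  under [RHS]eq_bigr do rewrite big_distrr /=.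
  rewrite [RHS]exchange_big /=; apply: eq_bigr => e _.
  rewrite HV big_distrr big_distrl /=; apply: eq_bigr => i _.
  by rewrite (Qs e b); ring.
exists n, W; split => //.
- transitivity (\tr (Q *m B *m Q)).
    rewrite exchange_big; apply: eq_bigr => a _; rewrite HW.
    by apply: eq_bigr => i _; rewrite expr2.
  rewrite mxtrace_mulC mulmxA QQ /Q mulmxBl mul1mx /H mulmxBr Bstar_idem.
  rewrite !linearB /= Bstar_trace //; congr (_ - _); by case: BC.
- move=> W0; have QB : Q *m B = 0.
    apply/matrixP => a b; rewrite !mxE.
    under eq_bigr do rewrite HV big_distrr /=.
    rewrite exchange_big big1 // => i _ /=.
    under eq_bigr do rewrite mulrA.
    by rewrite -big_distrl /= -/(W i a) W0 mul0r.
  by move/eqP: QB; rewrite mulmxBl mul1mx subr_eq0 => /eqP.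
Qed.

Lemma inner_noise_ge : - ((6 * eta + lam / m) * offmass) <= inner N H.
Proof.
(* With p = 0 the bound [PN] is empty and says nothing about the sign of [eta], but both sides are
   0. *)
case: (posnP p) => [p0|p0].
  have noord (a : 'I_p) : False by have := ltn_ord a; rewrite [X in (_ < X)%N]p0.
  have -> : inner N H = 0 by rewrite innerE big1 // => a; case: (noord a).
  have -> : offmass = 0 by rewrite /offmass big1 // => a; case: (noord a).
  by rewrite mulr0 oppr0.
have PPN : `|inner (P *m N) (P *m H)| <= eta * (2 * offmass).
  by apply: inner_le_norm1 => //; [exact: eta0|exact: norm1_Bstar_mulH].
have PNP : `|inner (P *m N *m P) (P *m H)| <= eta * (2 * offmass).
  apply: inner_le_norm1 => //; [exact: eta0| |exact: norm1_Bstar_mulH].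
  move=> a b; rewrite mxE (le_trans (ler_norm_sum _ _ _)) //.
  apply: (@le_trans _ _ (\sum_c eta * P c b)).
    apply: ler_sum => c _; rewrite normrM (ger0_norm (Bstar_ge0 _ _)).
    by rewrite ler_wpM2r // Bstar_ge0.
  by rewrite -big_distrr /= Bstar_colsum mulr1.
have [n [W [HW W2 _]]] := centered_gram.
have QBQ : inner N (Q *m B *m Q) <= lam * (offmass / m).
  apply: le_trans (ler_wpM2l lam0 (trace_Bstar_mulH m0 hm)).
  rewrite -W2 big_distrr /=.
  suff -> : inner N (Q *m B *m Q) = \sum_(i < n) qf N (W i).
    by apply: ler_sum => i _; exact: qfN.
  rewrite innerE /qf exchange_big /= [RHS]exchange_big /= exchange_big /=.
  apply: eq_bigr => a _; rewrite exchange_big /=; apply: eq_bigr => b _.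
  by rewrite HW big_distrr.
(* P is symmetric and idempotent, so it can be copied from H onto N; each of the three terms is then
   at most [eta] times 2 [offmass], whence the factor 6. *)
have e1 : inner N (P *m H) = inner (P *m N) (P *m H).
  by rewrite /inner trmx_mul Bstar_tr -mulmxA (mulmxA P P) Bstar_idem.
have e2 : inner N (H *m P) = inner N (P *m H).
  rewrite /inner -[LHS]mxtrace_tr trmx_mul trmxK trmx_mul Bstar_tr tH tN.
  by rewrite mxtrace_mulC.
have e3 : inner N (P *m H *m P) = inner (P *m N *m P) (P *m H).
  rewrite /inner !trmx_mul Bstar_tr tN mulmxA mxtrace_mulC.
  by rewrite -!mulmxA (mulmxA P P H) Bstar_idem.
have innerB (A1 A2 : 'M[R]_p) : inner N (A1 - A2) = inner N A1 - inner N A2.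
  by rewrite /inner mulmxBr linearB.
have innerD (A1 A2 : 'M[R]_p) : inner N (A1 + A2) = inner N A1 + inner N A2.
  by rewrite /inner mulmxDr linearD.
rewrite comparison_decomposition 2!innerB innerD e2 e3 e1.
move: PPN PNP QBQ; rewrite !ler_norml => /andP[h1 _] /andP[_ h2] h3.
have -> : (6 * eta + lam / m) * offmass =
  3 * (eta * (2 * offmass)) + lam * (offmass / m) by ring.
by lra.
Qed.

End Noise.

(** Without mass outside the blocks P H = 0; its trace vanishes, hence so do all W_i of
    [centered_gram]. Then P B = B, and 0 = P H = P - B. *)
Lemma offmass_eq0 : offmass = 0 -> B = P.
Proof.
move=> off0.
have U0 : P *m H = 0.
  apply/matrixP => a b; rewrite [RHS]mxE; apply/eqP; rewrite -normr_eq0.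
  have := norm1_Bstar_mulH; rewrite off0 mulr0 => h.
  have h0 : \sum_b \sum_a `|(P *m H) a b| = 0.
    apply/eqP; rewrite eq_le h /=.
    by apply: sumr_ge0 => c _; apply: sumr_ge0.
  move/eqP: h0; rewrite psumr_eq0 => [|c _]; last exact: sumr_ge0.
  move=> /allP /(_ b (mem_index_enum _)) /=.
  by rewrite psumr_eq0 // => /allP /(_ a (mem_index_enum _)).
have [n [W [_ W2 WB]]] := centered_gram.
have PB : P *m B = B.
  apply: WB => i a; apply/eqP; rewrite -sqrf_eq0.
  move/eqP: W2; rewrite U0 mxtrace0 psumr_eq0 => [|j _]; last first.
    by apply: sumr_ge0 => c _; rewrite sqr_ge0.
  move=> /allP /(_ i (mem_index_enum _)) /=.
  rewrite psumr_eq0 => [|c _]; last by rewrite sqr_ge0.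
  by move=> /allP /(_ a (mem_index_enum _)).
by move/eqP: U0; rewrite mulmxBr Bstar_idem PB subr_eq0 => /eqP.
Qed.

(** Rows and columns of H sum to 0, so terms depending on one index alone can be added for free: c
    is replaced by - 1/2 of the associated squared distance. That distance is 0 inside a block,
    where P lives, so only the entries of B outside the blocks are left. *)
Lemma inner_signal (c : 'I_K -> 'I_K -> R) : (forall j k, c j k = c k j) ->
  \sum_a \sum_b c (grp a) (grp b) * H a b =
  2^-1 * \sum_b \sum_(a | grp a != grp b) (c (grp a) (grp a) + c (grp b) (grp b)
     - 2 * c (grp a) (grp b)) * B a b.
Proof.
move=> csym.
pose D a b := c (grp a) (grp a) + c (grp b) (grp b) - 2 * c (grp a) (grp b).
have e1 : \sum_a \sum_b c (grp a) (grp a) * H a b = 0.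
  by rewrite big1 // => a _; rewrite -big_distrr /= Hrow mulr0.
have e2 : \sum_a \sum_b c (grp b) (grp b) * H a b = 0.
  by rewrite exchange_big big1 // => a _; rewrite -big_distrr /= Hcol mulr0.
transitivity (- 2^-1 * \sum_a \sum_b D a b * H a b).
  transitivity (\sum_a \sum_b c (grp a) (grp b) * H a b
     - 2^-1 * (\sum_a \sum_b c (grp a) (grp a) * H a b)
     - 2^-1 * (\sum_a \sum_b c (grp b) (grp b) * H a b)).
    by rewrite e1 e2 !mulr0 !subr0.
  rewrite !big_distrr /= -!sumrB; apply: eq_bigr => a _.
  rewrite !big_distrr /= -!sumrB; apply: eq_bigr => b _.
  by rewrite /D; field.
rewrite mulNr -mulrN; congr (_ * _); rewrite exchange_big -sumrN.
apply: eq_bigr => b _; rewrite -sumrN [RHS]big_mkcond /=.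
apply: eq_bigr => a _; case: ifPn => ab.
  by rewrite HE (Bstar_block0 ab) sub0r mulrN opprK.
by rewrite /D; move: ab; rewrite negbK => /eqP ->; ring.
Qed.

(** Subtracting [x (grp b) b], which is constant along column b, makes the coefficient vanish inside
    the blocks. *)
Lemma inner_cross (x : 'I_K -> 'I_p -> R) :
  \sum_a \sum_b x (grp a) b * H a b =
  - \sum_b \sum_(a | grp a != grp b) (x (grp a) b - x (grp b) b) * B a b.
Proof.
rewrite exchange_big -sumrN; apply: eq_bigr => b _ /=.
transitivity (\sum_a (x (grp a) b - x (grp b) b) * H a b).
  under [RHS]eq_bigr do rewrite mulrBl.
  by rewrite sumrB -[X in _ = _ - X]big_distrr /= Hcol mulr0 subr0.
rewrite -sumrN [RHS]big_mkcond /=.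
apply: eq_bigr => a _; case: ifPn => ab.
  by rewrite HE (Bstar_block0 ab) sub0r mulrN.
by move: ab; rewrite negbK => /eqP ->; rewrite subrr mul0r.
Qed.

End Comparison.
End Partition.

(** * Quadratic forms and integer points *)

Section Lattice.
Context {R : realType}.

(* The derivative in one coordinate has a sign, so moving that coordinate to one
   of the two neighbouring integers loses at most the curvature term [mu]. *)
Lemma lattice_rounding p (N : 'M[R]_p) (mu : R) (w : 'I_p -> R) :
  (forall a b, N a b = N b a) -> 0 <= mu -> (forall a, - mu <= N a a) ->
  exists z : 'I_p -> int, (forall a, `|(z a)%:~R - w a| <= 1) /\
    qf N w <= qf N (fun a => (z a)%:~R) + p%:R * mu.
Proof.
move=> sN mu0 dN.
suff H k : (k <= p)%N -> exists z : 'I_p -> int,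
    (forall a, `|(z a)%:~R - w a| <= 1) /\
    qf N w <= qf N (fun a : 'I_p => if (a < k)%N then (z a)%:~R else w a) + k%:R * mu.
  have [z [z1 zq]] := H p (leqnn p); exists z; split => //.
  by move: zq; under [X in _ <= qf N X + _]eq_fun do rewrite ltn_ord.
elim: k => [_|k IHk kp].
  exists (fun a => Num.floor (w a)); split => [a|].
    have := floor_itv (w a); rewrite intrD => /andP[h1 h2].
    by rewrite distrC ger0_norm ?subr_ge0 // lerBlDl ltW // addrC.
  by rewrite mul0r addr0.
have [z [z1 zq]] := IHk (ltnW kp).
pose a := Ordinal kp.
pose y (b : 'I_p) := if (b < k)%N then (z b)%:~R else w b.
have [t0 [ht [i hi]]] : exists t : R, (0 <= t * (\sum_b N a b * y b) /\ `|t| <= 1)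
    /\ exists i : int, i%:~R = w a + t.
  have := floor_itv (w a); rewrite intrD => /andP[h1 h2].
  have [S0|S0] := leP 0 (\sum_b N a b * y b).
    have t0 : 0 <= (Num.floor (w a) + 1)%:~R - w a.
      by rewrite subr_ge0 intrD ltW.
    exists ((Num.floor (w a) + 1)%:~R - w a); split.
      by split; [exact: mulr_ge0|rewrite ger0_norm // intrD; lra].
    by exists (Num.floor (w a) + 1); lra.
  have t0 : (Num.floor (w a))%:~R - w a <= 0 by rewrite subr_le0.
  exists ((Num.floor (w a))%:~R - w a); split.
    by split; [apply: mulr_le0 => //; exact: ltW|rewrite ler0_norm //; lra].
  by exists (Num.floor (w a)); lra.
exists (fun b => if b == a then i else z b); split.
  by move=> b; case: eqP => // ->; rewrite hi addrAC subrr add0r; case: ht.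
have -> : (fun b : 'I_p => if (b < k.+1)%N then (if b == a then i else z b)%:~R else w b)
    = (fun b => y b + (if b == a then t0 else 0)).
  apply/funext => b; rewrite /y ltnS.
  have [->|ba] := eqVneq b a; first by rewrite /= leqnn ltnn hi.
  have : (b : nat) != k by apply: contra ba => /eqP e; apply/eqP/val_inj.
  by rewrite leq_eqVlt => /negbTE -> /=; rewrite addr0.
rewrite qf_add_delta //.
have [hS ht1] := ht.
have ht2 : t0 ^+ 2 <= 1 by rewrite -real_normK ?num_real // expr_le1.
have : - mu <= t0 ^+ 2 * N a a.
  have t00 := sqr_ge0 t0; have := dN a; have := mu0; nra.
rewrite -/y in zq; rewrite -natr1 mulrDl mul1r.
move: zq hS; set S := \sum_b _; set A := qf N w; set B := qf N y.
move=> zq hS h.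
by rewrite (le_trans zq) //; lra.
Qed.

Lemma qf_scale p (N : 'M[R]_p) (c : R) v :
  qf N (fun a => c * v a) = c ^+ 2 * qf N v.
Proof.
rewrite /qf big_distrr; apply: eq_bigr => a _ /=.
by rewrite big_distrr; apply: eq_bigr => b _ /=; ring.
Qed.

(** By homogeneity v may be scaled to squared norm p. Rounding then costs p [mu], which is [mu]
    times the squared norm, and the integer point, at distance at most 1 in each coordinate, has
    squared norm at most 2 p + 2 p. *)
Lemma qf_le_lattice p (N : 'M[R]_p) (lam mu : R) : (0 < p)%N ->
  (forall a b, N a b = N b a) -> 0 <= mu -> (forall a, - mu <= N a a) ->
  (forall z : 'I_p -> int, \sum_a (z a)%:~R ^+ 2 <= (4 * p)%:R :> R ->
     qf N (fun a => (z a)%:~R) <= lam * p%:R) ->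
  forall v, qf N v <= (lam + mu) * \sum_a v a ^+ 2.
Proof.
move=> p0 sN mu0 dN hz v; set s := \sum_a _.
have s0 : 0 <= s by apply: sumr_ge0 => a _; rewrite sqr_ge0.
have p0' : 0 < p%:R :> R by rewrite ltr0n.
have [se|sn] := eqVneq s 0.
  rewrite se mulr0 /qf big1 // => a _; rewrite big1 // => b _.
  have -> : v a = 0.
    apply/eqP; rewrite -sqrf_eq0; move/eqP: se.
    rewrite psumr_eq0 => [|c _]; last by rewrite sqr_ge0.
    by move=> /allP /(_ a (mem_index_enum _)).
  by rewrite mul0r mulr0.
have sp : 0 < s by rewrite lt_neqAle eq_sym sn.
pose c := Num.sqrt (p%:R / s).
have c2 : c ^+ 2 = p%:R / s by rewrite sqr_sqrtr // divr_ge0 // ltW.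
have [z [z1 zq]] := lattice_rounding (fun a => c * v a) sN mu0 dN.
have {}hz : qf N (fun a => (z a)%:~R) <= lam * p%:R.
  apply: hz.
  apply: (@le_trans _ _ (\sum_a (2 * (c * v a) ^+ 2 + 2))).
    apply: ler_sum => a _; set d := (z a)%:~R - c * v a.
    have -> : (z a)%:~R = c * v a + d by rewrite /d addrC subrK.
    have d1 : d ^+ 2 <= 1 by rewrite -real_normK ?num_real // expr_le1 // z1.
    have := sqr_ge0 (c * v a - d); lra.
  rewrite big_split /= sumr_const card_ord -big_distrr /=.
  under eq_bigr do rewrite exprMn.
  rewrite -big_distrr /= c2 -/s divfK // natrM -[2 *+ p]mulr_natr; lra.
have : c ^+ 2 * qf N v <= (lam + mu) * p%:R.
  by rewrite -qf_scale (le_trans zq) // mulrDl (mulrC mu) lerD2r.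
rewrite c2 mulrAC ler_pdivrMr // mulrC -mulrA (mulrC p%:R) mulrA.
by rewrite ler_pM2r.
Qed.

(** A finite type that covers the ball: an integer coordinate with square at most 4 p lies between -
    2 p and 2 p, and is stored shifted by 2 p. *)
Definition lattice_index p := {ffun 'I_p -> 'I_(4 * p).+1}.

Definition lattice_point p (f : lattice_index p) (a : 'I_p) : int :=
  (f a)%:Z - (2 * p)%:Z.

Definition lattice_ball p (f : lattice_index p) : bool :=
  \sum_a (lattice_point f a) ^+ 2 <= (4 * p)%:Z.

Lemma lattice_pointP p (z : 'I_p -> int) :
  \sum_a (z a)%:~R ^+ 2 <= (4 * p)%:R :> R ->
  exists2 f : lattice_index p, lattice_ball f & lattice_point f = z.
Proof.
move=> hz.
have hz' : \sum_a (z a) ^+ 2 <= (4 * p)%:Z.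
  rewrite -(ler_int R) rmorph_sum /=.
  by under eq_bigr do rewrite rmorphXn /=.
have za a : (z a) ^+ 2 <= (4 * p)%:Z.
  apply: le_trans hz'; rewrite (bigD1 a) //= lerDl.
  by apply: sumr_ge0 => b _; rewrite sqr_ge0.
have zb a : (0 <= z a + (2 * p)%:Z) && (z a + (2 * p)%:Z <= (4 * p)%:Z).
  have := za a; have := ltn_ord a; nia.
pose f : lattice_index p := [ffun a => inord `|z a + (2 * p)%:Z|].
have fz : lattice_point f = z.
  apply/funext => a; rewrite /lattice_point ffunE inordK.
    by have := zb a; lia.
  by have := zb a; lia.
by exists f => //; rewrite /lattice_ball fz.
Qed.

Lemma sum_half_pow n : \sum_(j < n) 2^-1 ^+ j <= 2 :> R.
Proof.
suff -> : \sum_(j < n) 2^-1 ^+ j = 2 - 2 * 2^-1 ^+ n :> R.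
  by rewrite lerBlDr lerDl mulr_ge0 // exprn_ge0 // invr_ge0.
elim: n => [|n IH]; first by rewrite big_ord0 expr0; lra.
by rewrite big_ord_recr /= IH exprS; field.
Qed.

(** Exponential weights: |z| <= z^2 for integers, so at a point of the ball 2^(4p) times the product
    of the 2^(-|z_a|) is at least 1. The sum over all points factors into p one-dimensional sums,
    each at most 1 + 2 and bounded by 4, whence 16 * 4 = 64. *)
Lemma card_lattice_ball p :
  (#|[pred f : lattice_index p | lattice_ball f]|%:R : R) <= 64 ^+ p.
Proof.
pose g (k : 'I_(4 * p).+1) : R := 2^-1 ^+ `|(k : nat)%:Z - (2 * p)%:Z|%N.
have g0 k : 0 <= g k by rewrite exprn_ge0 // invr_ge0.
have sg : \sum_k g k <= 4.
  pose G (k : nat) : R := 2^-1 ^+ `|k%:Z - (2 * p)%:Z|%N.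
  have -> : \sum_k g k = \sum_(0 <= k < (2 * p)) G k + \sum_((2 * p) <= k < (4 * p).+1) G k.
    by rewrite -big_cat_nat ?big_mkord //=; lia.
  have -> : \sum_(0 <= k < 2 * p) G k = \sum_(j < 2 * p) 2^-1 ^+ j.+1.
    rewrite big_nat_rev /= big_mkord; apply: eq_bigr => j _.
    by rewrite /G; congr (_ ^+ _); have := ltn_ord j; lia.
  have -> : \sum_(2 * p <= k < (4 * p).+1) G k = \sum_(j < (2 * p).+1) 2^-1 ^+ j.
    rewrite -{1}[(2 * p)%N]add0n big_addn.
    have -> : ((4 * p).+1 - 2 * p)%N = (2 * p).+1 by lia.
    rewrite big_mkord; apply: eq_bigr => j _.
    by rewrite /G; congr (_ ^+ _); lia.
  under eq_bigr do rewrite exprS.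
  rewrite -big_distrr /=; have := sum_half_pow (2 * p).
  by have := sum_half_pow (2 * p).+1; lra.
have : (#|[pred f : lattice_index p | lattice_ball f]|%:R : R) <=
    \sum_(f : lattice_index p) 2 ^+ (4 * p) * \prod_a g (f a).
  rewrite -sum1_card natr_sum big_mkcond /=; apply: ler_sum => f _.
  case: ifPn => fb; last first.
    by rewrite mulr_ge0 ?exprn_ge0 // prodr_ge0.
  have sz : (\sum_a `|lattice_point f a|%N <= 4 * p)%N.
    move: fb; rewrite /lattice_ball -lez_nat => /(le_trans _) -> //.
    rewrite rmorph_sum; apply: ler_sum => a _ /=; nia.
  rewrite /g prodrXr -[leLHS](@mulfV _ (2 ^+ (4 * p))) ?expf_neq0 //.
  rewrite ler_wpM2l ?exprn_ge0 // -exprVn.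
  by apply: ler_wiXn2l => //; lra.
rewrite -big_distrr /= -(bigA_distr_bigA (fun a k => g k)) /= => /le_trans; apply.
have -> : 64 ^+ p = 2 ^+ (4 * p) * 4 ^+ p :> R.
  by rewrite exprM -exprMn; congr (_ ^+ _); lra.
rewrite ler_wpM2l ?exprn_ge0 // prodr_const card_ord.
by rewrite lerXn2r // nnegrE ?sumr_ge0.
Qed.

End Lattice.

(** * Independence *)

Section Independence.
Context {R : realType} d (T : measurableType d) (P : probability T R).

(** For fixed B both sides are finite measures in A that agree on the pi-system G. *)
Lemma indep_sigma_left (G : set (set T)) (B : set T) :
  G `<=` measurable -> setI_closed G -> G setT -> measurable B ->
  (forall A, G A -> P (A `&` B) = (P A * P B)%E) ->
  forall A, <<s G >> A -> P (A `&` B) = (P A * P B)%E.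
Proof.
move=> mG IG GT mB hG A sA.
have PB0 : 0 <= fine (P B) by rewrite fine_ge0.
have PBE : P B = (fine (P B))%:E by rewrite fineK // fin_num_measure.
pose c := NngNum PB0.
have := @g_sigma_algebra_measure_unique d R T G mG (fun=> setT) (fun=> GT) _
  (mrestr P mB) (mscale c P) IG.
rewrite /mrestr /mscale => /(_ _ _ _ A sA) h.
rewrite PBE muleC; apply: h.
- by apply/seteqP; split => // x _; exists 0%N.
- by move=> X GX; have h1 := hG X GX; rewrite muleC PBE in h1; exact: h1.
- move=> _; apply: le_lt_trans (probability_le1 P (measurableI _ _ measurableT mB)) _.
  exact: ltry.
Qed.

Lemma indep_sigma (G1 G2 : set (set T)) :
  G1 `<=` measurable -> setI_closed G1 -> G1 setT ->
  G2 `<=` measurable -> setI_closed G2 -> G2 setT ->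
  (forall A B, G1 A -> G2 B -> P (A `&` B) = (P A * P B)%E) ->
  forall A B, <<s G1 >> A -> <<s G2 >> B -> P (A `&` B) = (P A * P B)%E.
Proof.
move=> mG1 IG1 G1T mG2 IG2 G2T h A B sA sB.
have sGm (G : set (set T)) : G `<=` measurable -> <<s G >> `<=` measurable.
  by move=> mG; apply: smallest_sub => //; exact: sigma_algebra_measurable.
apply: (@indep_sigma_left G1) => //; first exact: sGm sB.
move=> A1 GA1; rewrite setIC muleC.
apply: (@indep_sigma_left G2) => //; first exact: mG1.
by move=> B1 GB1; rewrite setIC muleC; exact: h.
Qed.

Definition indep_rv (X Y : T -> R) := forall A B : set R,
  measurable A -> measurable B ->
  P (X @^-1` A `&` Y @^-1` B) = (P (X @^-1` A) * P (Y @^-1` B))%E.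

(** The joint law is the product of the marginals, by uniqueness of the product measure; Tonelli
    does the rest. *)
Lemma indep_rv_integral (X Y : {RV P >-> R}) (h : R * R -> R) :
  indep_rv X Y -> measurable_fun setT h -> (forall z, 0 <= h z) ->
  (\int[P]_w (h (X w, Y w))%:E =
   \int[distribution P X]_x \int[distribution P Y]_y (h (x, y))%:E)%E.
Proof.
move=> XY mh h0.
have mXY : measurable_fun setT (fun w => (X w, Y w)).
  by apply: measurable_fun_pair; exact: measurable_funP.
have mEh : measurable_fun setT (EFin \o h) by exact/measurable_EFinP.
have hE0 z : (0 <= (EFin \o h) z)%E by rewrite lee_fin.
have := @fubini_tonelli1 _ _ _ _ R (distribution P X) (distribution P Y) _ mEh hE0.
rewrite /fubini_F /= => <-.
transitivity (\int[pushforward P (fun w => (X w, Y w))]_z (EFin \o h) z)%E.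
  by rewrite ge0_integral_pushforward // => ? _; exact: hE0.
pose f := mfun_Sub (mem_set mXY : (fun w => (X w, Y w)) \in mfun).
apply: eq_measure_integral => A mA _; apply/esym.
apply: (@product_measure_unique _ _ _ _ R (distribution P X) (distribution P Y)
  (pushforward P f)) => // *; exact: XY.
Qed.

Section Groups.
Variables (I J : finType) (g : I -> J) (Y : I -> T -> R).
Hypothesis mY : forall i, measurable_fun setT (Y i).
Hypothesis iY : indep_groups P g Y.

(** A pi-system generating the sigma-algebra of the variables whose group satisfies Q. It consists
    of rectangles because [indep_groups] is a product rule on rectangles. *)
Definition group_cylinders (Q : pred J) : set (set T) :=
  [set S | exists A : I -> set R, (forall i, measurable (A i)) /\
     S = \bigcap_(i in [set i | Q (g i)]) (Y i @^-1` A i)].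

Let mpre i (A : set R) : measurable A -> measurable (Y i @^-1` A).
Proof. by move=> mA; rewrite -[_ @^-1` _]setTI; exact: mY. Qed.

Lemma group_cylinders_measurable Q : group_cylinders Q `<=` measurable.
Proof.
move=> _ [A [mA ->]]; apply: fin_bigcap_measurable => [|i _].
  exact: finite_finset.
exact: mpre.
Qed.

Lemma group_cylindersT Q : group_cylinders Q setT.
Proof.
exists (fun=> setT); split => //; apply/seteqP; split => // x _ i _ //.
Qed.

Lemma group_cylindersI Q : setI_closed (group_cylinders Q).
Proof.
move=> _ _ [A [mA ->]] [B [mB ->]]; exists (fun i => A i `&` B i).
split; first by move=> i; exact: measurableI.
by rewrite -bigcapI; apply: eq_bigcapr => i _; rewrite preimage_setI.
Qed.

(** Variables outside Q receive [setT], so that the product rule over all groups applies and the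
    extra factors are 1. *)
Lemma prob_group_cylinder (Q : pred J) (A : I -> set R) :
  (forall i, measurable (A i)) ->
  P (\bigcap_(i in [set i | Q (g i)]) (Y i @^-1` A i)) =
  (\big[*%E/1%E]_(j | Q j) P (\bigcap_(i in [set i | g i = j]) (Y i @^-1` A i)))%E.
Proof.
move=> mA; pose A' i := if Q (g i) then A i else setT.
have mA' i : measurable (A' i) by rewrite /A'; case: ifP.
transitivity (P (\bigcap_(i in [set: I]) (Y i @^-1` A' i))).
  congr (P _); apply/seteqP; split => x h i /=.
    by move=> _; rewrite /A'; case: ifP => // Qi; apply: h.
  by move=> Qi; have := h i Logic.I; rewrite /A' Qi.
rewrite iY // [RHS]big_mkcond; apply: eq_bigr => j _; case: ifPn => Qj.
  by congr (P _); apply: eq_bigcapr => i /= ij; rewrite /A' ij Qj.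
rewrite -[RHS](probability_setT P); congr (P _).
apply/seteqP; split => // x _ i /= ij; rewrite /A' ij (negbTE Qj) //.
Qed.

Lemma group_cylinders_indep (Q1 Q2 : pred J) :
  (forall j, Q1 j -> Q2 j -> false) ->
  forall S1 S2, group_cylinders Q1 S1 -> group_cylinders Q2 S2 ->
  P (S1 `&` S2) = (P S1 * P S2)%E.
Proof.
move=> Q12 _ _ [A1 [mA1 ->]] [A2 [mA2 ->]].
pose A i := if Q1 (g i) then A1 i else A2 i.
have mA i : measurable (A i) by rewrite /A; case: ifP.
have nQ j : Q2 j -> Q1 j = false.
  by move=> q2; apply/negbTE/negP => q1; have := Q12 _ q1 q2.
have e1 : \bigcap_(i in [set i | Q1 (g i)]) (Y i @^-1` A1 i) =
    \bigcap_(i in [set i | Q1 (g i)]) (Y i @^-1` A i).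
  by apply: eq_bigcapr => i /= Qi; rewrite /A Qi.
have e2 : \bigcap_(i in [set i | Q2 (g i)]) (Y i @^-1` A2 i) =
    \bigcap_(i in [set i | Q2 (g i)]) (Y i @^-1` A i).
  by apply: eq_bigcapr => i /= Qi; rewrite /A (nQ _ Qi).
have e12 : \bigcap_(i in [set i | Q1 (g i)]) (Y i @^-1` A i) `&`
    \bigcap_(i in [set i | Q2 (g i)]) (Y i @^-1` A i) =
    \bigcap_(i in [set i | (predU Q1 Q2) (g i)]) (Y i @^-1` A i).
  apply/seteqP; split => x.
    by move=> [h1 h2] i /= /orP[] Qi; [exact: h1|exact: h2].
  by move=> h; split => i /= Qi; apply: h => /=; rewrite Qi ?orbT.
rewrite e1 e2 e12 !prob_group_cylinder //.
rewrite (bigID Q1) /=; congr (_ * _)%E; apply: eq_bigl => j.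
  by case: (Q1 j); rewrite ?andbF.
by case q2: (Q2 j); rewrite ?orbT ?orbF ?(nQ _ q2) // andbN.
Qed.

Notation sigmaT Q := (g_sigma_algebraType (group_cylinders Q)).

(** Dependence on the groups in Q alone, phrased as measurability for the generated sigma-algebra so
    that sums, products and squares inherit it from the usual closure rules. *)
Definition group_measurable (Q : pred J) (f : T -> R) :=
  measurable_fun setT (f : sigmaT Q -> R).

Lemma group_measurable_var (Q : pred J) i : Q (g i) -> group_measurable Q (Y i).
Proof.
move=> Qi _ B mB; rewrite setTI; apply: sub_sigma_algebra.
exists (fun k => if k == i then B else setT); split.
  by move=> k; case: ifP.
apply/seteqP; split => x /=.
  by move=> Bx k /= _; case: eqP => // ->.
by move=> /(_ i Qi) /=; rewrite eqxx.
Qed.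

Lemma group_measurableS (Q Q' : pred J) f : (forall j, Q j -> Q' j) ->
  group_measurable Q f -> group_measurable Q' f.
Proof.
move=> QQ' mf _ B mB; have := mf measurableT B mB; rewrite !setTI.
apply: smallest_sub; first exact: smallest_sigma_algebra.
move=> _ [A [mA ->]]; apply: sub_sigma_algebra.
exists (fun i => if Q (g i) then A i else setT); split.
  by move=> k; case: ifP.
apply/seteqP; split => x h i /=.
  by move=> _; case: ifP => // Qi; exact: h.
by move=> Qi; have := h i (QQ' _ Qi); rewrite Qi.
Qed.

Lemma group_measurableT Q f : group_measurable Q f -> measurable_fun setT f.
Proof.
move=> mf _ B mB; have := mf measurableT B mB.
apply: smallest_sub; first exact: sigma_algebra_measurable.
exact: group_cylinders_measurable.
Qed.

Lemma group_measurable_indep (Q1 Q2 : pred J) f1 f2 :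
  (forall j, Q1 j -> Q2 j -> false) ->
  group_measurable Q1 f1 -> group_measurable Q2 f2 -> indep_rv f1 f2.
Proof.
move=> Q12 m1 m2 A B mA mB.
apply: (indep_sigma _ _ _ _ _ _ (group_cylinders_indep Q12)) => //.
- exact: group_cylinders_measurable.
- exact: group_cylindersI.
- exact: group_cylindersT.
- exact: group_cylinders_measurable.
- exact: group_cylindersI.
- exact: group_cylindersT.
- by have := m1 measurableT A mA; rewrite setTI.
- by have := m2 measurableT B mB; rewrite setTI.
Qed.

(** [pi] merges groups into coarser labels: a row of the model holds two groups, one for Z and one
    for E, whereas the factors here are indexed by rows. In the induction [F l] is independent of
    the sum over the remaining labels. *)
Lemma expR_sum_indep (L : eqType) (pi : J -> L) (F : L -> T -> R) (s : seq L) :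
  (forall l, group_measurable [pred j | pi j == l] (F l)) -> uniq s ->
  (\int[P]_w (expR (\sum_(l <- s) F l w))%:E =
   \big[*%E/1%E]_(l <- s) \int[P]_w (expR (F l w))%:E)%E.
Proof.
move=> mF; elim: s => [_|l s IH /= /andP[ls us]].
  rewrite big_nil; under eq_integral do rewrite big_nil expR0.
  by rewrite integral_cst // mul1e; exact: probability_setT.
have ms : group_measurable [pred j | pi j \in s] (fun w => \sum_(k <- s) F k w).
  elim: s {IH ls us} => [|k s IHs].
    rewrite [X in group_measurable _ X](_ : _ = cst 0); last first.
      by apply/funext => w; rewrite big_nil.
    exact: measurable_cst.
  rewrite [X in group_measurable _ X](_ : _ = F k \+ (fun w => \sum_(k <- s) F k w)); last first.
    by apply/funext => w; rewrite big_cons.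
  apply: measurable_funD.
    by apply: group_measurableS (mF k) => j /= /eqP ->; rewrite mem_head.
  by apply: group_measurableS IHs => j /=; rewrite inE => ->; rewrite orbT.
have ind : indep_rv (F l) (fun w => \sum_(k <- s) F k w).
  apply: group_measurable_indep (mF l) ms => j /= /eqP ->.
  by rewrite (negbTE ls).
pose X := mfun_Sub (mem_set (group_measurableT (mF l)) : F l \in mfun).
pose S := mfun_Sub (mem_set (group_measurableT ms)
  : (fun w => \sum_(k <- s) F k w) \in mfun).
have := @indep_rv_integral X S (fun z => expR z.1 * expR z.2) ind.
have mh : measurable_fun setT (fun z : R * R => expR z.1 * expR z.2).
  apply: measurable_funM; apply: (measurableT_comp (@measurable_expR R)).
    exact: measurable_fst.
  exact: measurable_snd.
move=> /(_ mh) h; rewrite big_cons -(IH us).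
under eq_integral do rewrite big_cons expRD.
rewrite [LHS]h => [|z]; last by rewrite mulr_ge0 // expR_ge0.
have mE : measurable_fun setT (fun x : R => (expR x)%:E).
  by apply/measurable_EFinP; exact: measurable_expR.
have e0 (x : R) : (0 <= (expR x)%:E)%E by rewrite lee_fin expR_ge0.
transitivity (\int[distribution P X]_x
    ((expR x)%:E * \int[distribution P S]_y (expR y)%:E))%E.
  by apply: eq_integral => x _; rewrite -ge0_integralZl.
rewrite ge0_integralZr //; last by apply: integral_ge0.
by rewrite !ge0_integral_distribution.
Qed.

End Groups.
End Independence.

(** * Gaussian moments and deviation bounds *)

Section GaussianMoments.
Context {R : realType}.
Local Notation mu := (@lebesgue_measure R).

(** [normal_prob] is given by integrating its density over sets, so its Radon-Nikodym derivative
    equals [normal_pdf] almost everywhere. *)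
Lemma ge0_integral_normal_prob (m s : R) (f : R -> R) :
  measurable_fun setT f -> (forall x, 0 <= f x) ->
  (\int[normal_prob m s]_x (f x)%:E =
   \int[mu]_x (f x * normal_pdf m s x)%:E)%E.
Proof.
move=> mf f0.
have mEf : measurable_fun setT (EFin \o f) by exact/measurable_EFinP.
have dom : normal_prob m s `<< mu by exact: normal_prob_dominates.
have mpdf : measurable_fun setT (EFin \o normal_pdf m s).
  by apply/measurable_EFinP; exact: measurable_normal_pdf.
rewrite -(Radon_Nikodym_SigmaFinite.change_of_variables dom (f := EFin \o f)) //=.
under [RHS]eq_integral do rewrite EFinM.
have RNint := Radon_Nikodym_SigmaFinite.f_integrable dom.
apply: ae_eq_integral => //.
- by apply: emeasurable_funM => //; exact: measurable_int RNint.
- exact: emeasurable_funM.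
- apply: ae_eqe_mul2l; apply: integral_ae_eq => //.
  by move=> E _ mE; rewrite -Radon_Nikodym_SigmaFinite.f_integral.
Qed.

(** With w = 1 - 2 t v, the factor exp (t x^2) turns the density of variance v into w^(-1/2) times
    the density of variance v / w. *)
Lemma normal_mgf_sq (v t : R) : 0 < v -> 2 * t * v < 1 ->
  (\int[normal_prob 0 (Num.sqrt v)]_x (expR (t * x ^+ 2))%:E =
   ((Num.sqrt (1 - 2 * t * v))^-1)%:E)%E.
Proof.
move=> v0 tv; set w := 1 - 2 * t * v.
have w0 : 0 < w by rewrite subr_gt0.
rewrite ge0_integral_normal_prob; last 2 first.
- by apply: measurableT_comp => //; exact: measurable_funM.
- by move=> x; exact: expR_ge0.
have sv : Num.sqrt v != 0 by rewrite gt_eqF // sqrtr_gt0.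
have sw : Num.sqrt (v / w) != 0 by rewrite gt_eqF // sqrtr_gt0 divr_gt0.
transitivity (\int[mu]_x ((Num.sqrt w)^-1%:E * (normal_pdf 0 (Num.sqrt (v / w)) x)%:E))%E.
  apply: eq_integral => x _; rewrite -EFinM; congr EFin.
  rewrite !normal_pdfE // /normal_peak /normal_fun !subr0.
  rewrite !sqr_sqrtr ?divr_ge0 1?ltW // mulrCA [RHS]mulrA -expRD; congr (_ * expR _).
    rewrite -invfM -sqrtrM ?ltW //; congr (_^-1); congr Num.sqrt.
    by field; rewrite gt_eqF.
  by rewrite /w; field; rewrite -/w !gt_eqF.
rewrite ge0_integralZl // ?integral_normal_pdf ?mule1 //.
- by apply/measurable_EFinP; exact: measurable_normal_pdf.
- by move=> x _; rewrite lee_fin normal_pdf_ge0.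
Qed.

(** Completing the square: the tilted density has mean t v and the same variance. *)
Lemma normal_mgf (v t : R) : 0 < v ->
  (\int[normal_prob 0 (Num.sqrt v)]_x (expR (t * x))%:E =
   (expR (t ^+ 2 * v / 2))%:E)%E.
Proof.
move=> v0.
rewrite ge0_integral_normal_prob; last 2 first.
- by apply: measurableT_comp => //; exact: measurable_funM.
- by move=> x; exact: expR_ge0.
have sv : Num.sqrt v != 0 by rewrite gt_eqF // sqrtr_gt0.
transitivity (\int[mu]_x ((expR (t ^+ 2 * v / 2))%:E * (normal_pdf (t * v) (Num.sqrt v) x)%:E))%E.
  apply: eq_integral => x _; rewrite -EFinM; congr EFin.
  rewrite !normal_pdfE // /normal_fun.
  rewrite !sqr_sqrtr 1?ltW // mulrCA [RHS]mulrCA -!expRD; congr (_ * expR _).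
  by field; rewrite gt_eqF.
rewrite ge0_integralZl // ?integral_normal_pdf ?mule1 //.
- by apply/measurable_EFinP; exact: measurable_normal_pdf.
- by move=> x _; rewrite lee_fin normal_pdf_ge0.
Qed.

Context d (T : measurableType d) (P : probability T R).

(* [normal_prob] lives on the sigma-algebra generated by the half-open
   intervals, whose display differs from the one of [R]. *)
Lemma normal_law_integral (X : {RV P >-> R}) (v : R) (f : R -> R) :
  0 < v -> centered_normal_law P X v ->
  measurable_fun setT f -> (forall x, 0 <= f x) ->
  (\int[distribution P X]_x (f x)%:E =
   \int[normal_prob 0 (Num.sqrt v)]_x (f x)%:E)%E.
Proof.
move=> v0 [mX law] mf f0.
have mEf : measurable_fun setT (EFin \o f) by exact/measurable_EFinP.
pose B : measurableType _ := g_sigma_algebraType R.-ocitv.-measurable.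
have mX' : measurable_fun setT (X : T -> B) by move=> mT A mA; exact: mX.
pose X' : {RV P >-> B} := mfun_Sub (mem_set mX' : (X : T -> B) \in mfun).
have mf' : measurable_fun setT (EFin \o f : B -> \bar R).
  by move=> mT A mA; exact: mEf.
transitivity (\int[distribution P X']_x (EFin \o f) x)%E.
  rewrite (@ge0_integral_distribution _ _ _ _ _ P X (EFin \o f)) //.
  by rewrite ge0_integral_distribution // => y; rewrite lee_fin.
apply: eq_measure_integral => A mA _.
by have := law A mA; rewrite gt_eqF.
Qed.

Lemma normal_law_mgf_sq (X : T -> R) (v t : R) :
  0 < v -> centered_normal_law P X v -> 2 * t * v < 1 ->
  (\int[P]_w (expR (t * X w ^+ 2))%:E =
   ((Num.sqrt (1 - 2 * t * v))^-1)%:E)%E.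
Proof.
move=> v0 law tv; have [mX _] := law.
pose X' := mfun_Sub (mem_set mX : X \in mfun).
have mf : measurable_fun setT (fun x : R => expR (t * x ^+ 2)).
  by apply: measurableT_comp => //; exact: measurable_funM.
rewrite -normal_mgf_sq // -(@normal_law_integral X' v (fun x => expR (t * x ^+ 2))) //.
by rewrite ge0_integral_distribution //; exact/measurable_EFinP.
Qed.

(** Integrating over Y with X fixed gives exp (t^2 u X^2 / 2), and [normal_mgf_sq] with parameter
    t^2 u / 2 gives the second integral. *)
Lemma normal_law_mgf_prod (X Y : T -> R) (v u t : R) : 0 < v -> 0 < u ->
  centered_normal_law P X v -> centered_normal_law P Y u -> indep_rv P X Y ->
  t ^+ 2 * (v * u) < 1 ->
  (\int[P]_w (expR (t * (X w * Y w)))%:E =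
   ((Num.sqrt (1 - t ^+ 2 * (v * u)))^-1)%:E)%E.
Proof.
move=> v0 u0 lawX lawY XY tuv; have [mX _] := lawX; have [mY _] := lawY.
pose X' := mfun_Sub (mem_set mX : X \in mfun).
pose Y' := mfun_Sub (mem_set mY : Y \in mfun).
have mh : measurable_fun setT (fun z : R * R => expR (t * (z.1 * z.2))).
  apply: (measurableT_comp (@measurable_expR R)); apply: measurable_funM => //.
  apply: measurable_funM; [exact: measurable_fst|exact: measurable_snd].
rewrite (@indep_rv_integral _ _ _ P X' Y' (fun z => expR (t * (z.1 * z.2)))) //.
transitivity (\int[distribution P X']_x (expR (t ^+ 2 * u / 2 * x ^+ 2))%:E)%E.
  apply: eq_integral => x _ /=.
  rewrite (@normal_law_integral Y' u (fun y => expR (t * (x * y)))) //; last first.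
    by apply: measurableT_comp => //; apply: measurable_funM.
  under eq_integral do rewrite mulrA.
  by rewrite normal_mgf //; congr ((expR _)%:E); field.
have mf : measurable_fun setT (fun x : R => expR (t ^+ 2 * u / 2 * x ^+ 2)).
  by apply: measurableT_comp => //; exact: measurable_funM.
rewrite (@normal_law_integral X' v _ v0 lawX mf (fun x => expR_ge0 _)).
rewrite normal_mgf_sq //.
  by congr ((Num.sqrt _)^-1%:E); field.
by apply: le_lt_trans tuv; rewrite le_eqVlt; apply/orP; left; apply/eqP; field.
Qed.

Lemma chernoff_bound (F : T -> R) (c a : R) : measurable_fun setT F ->
  (\int[P]_w (expR (F w))%:E <= c%:E)%E ->
  (P [set w | (a <= F w)%R] <= (c * expR (- a))%:E)%E.
Proof.
move=> mF hc; pose X := mfun_Sub (mem_set mF : F \in mfun).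
have := @chernoff _ T R P X 1 a ltr01.
rewrite mul1r => /le_trans; apply; rewrite EFinM; apply: lee_wpmul2r.
  by rewrite lee_fin expR_ge0.
rewrite /mmt_gen_fun unlock /=; apply: le_trans hc.
by under eq_integral do rewrite /= mulr1.
Qed.

End GaussianMoments.

(** * Deviation rates and Chernoff bounds *)

Section Rates.
Context {R : realType}.

(** Relative deviation at which n squares or products have a tail of at most exp (- n y): the root
    is the Gaussian regime, the linear term the exponential one. *)
Definition rate (y : R) : R := 4 * Num.sqrt y + 16 * y.

Lemma rate_ge0 y : 0 <= y -> 0 <= rate y.
Proof. by move=> y0; rewrite addr_ge0 ?mulr_ge0 // sqrtr_ge0. Qed.

(** The witness is the minimum of 1 and [rate y]. Chernoff parameters are taken proportional to it,
    and the cap keeps the moments finite. Since 16 y is the square of 4 sqrt y, the last bound holds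
    in both regimes. *)
Lemma rate_split y : 0 <= y ->
  exists t, [/\ 0 <= t, t <= 1, t <= rate y & 16 * y <= t * rate y].
Proof.
move=> y0; have r0 := rate_ge0 y0.
have [r1|r1] := leP (rate y) 1.
  exists (rate y); split => //; rewrite /rate.
  have s0 := sqrtr_ge0 y; have sy : Num.sqrt y ^+ 2 = y by exact: sqr_sqrtr.
  move: s0 sy; set s := Num.sqrt y => s0 sy.
  rewrite -[X in 16 * X]sy; nra.
exists 1; split => //; first exact: ltW.
by rewrite mul1r /rate lerDr mulr_ge0 // sqrtr_ge0.
Qed.

Lemma invsqrt_le_expR (a x : R) : 0 < a -> 1 <= a * expR x ->
  (Num.sqrt a)^-1 <= expR (x / 2).
Proof.
move=> a0 h; rewrite -[leLHS]mul1r ler_pdivrMr ?sqrtr_gt0 //.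
rewrite -(@ler_pXn2r _ 2) ?nnegrE ?mulr_ge0 ?expR_ge0 ?sqrtr_ge0 //.
have e : expR (x / 2) ^+ 2 = expR x by rewrite -expRM_natl; congr expR; field.
by rewrite expr1n exprMn sqr_sqrtr ?(ltW a0) // e mulrC.
Qed.

(** The product (1 - t) (1 + t + 2 t^2) equals 1 + t^2 (1 - 2 t), at least 1 up to t = 1/2. *)
Lemma chi2_mgf_upper (t : R) : 0 <= t -> t <= 2^-1 ->
  (Num.sqrt (1 - t))^-1 <= expR ((t + 2 * t ^+ 2) / 2).
Proof.
move=> t0 t1; apply: invsqrt_le_expR; first lra.
apply: (@le_trans _ _ ((1 - t) * (1 + (t + 2 * t ^+ 2)))); first nra.
by rewrite ler_wpM2l ?expR_ge1Dx //; lra.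
Qed.

(** Here (1 + t) (1 - t + t^2) = 1 + t^3, so t may be arbitrarily large. *)
Lemma chi2_mgf_lower (t : R) : 0 <= t ->
  (Num.sqrt (1 + t))^-1 <= expR ((- t + t ^+ 2) / 2).
Proof.
move=> t0; apply: invsqrt_le_expR; first lra.
apply: (@le_trans _ _ ((1 + t) * (1 + (- t + t ^+ 2)))); first nra.
by rewrite ler_wpM2l ?expR_ge1Dx //; lra.
Qed.

End Rates.

Section Tails.
Context {R : realType} d (T : measurableType d) (P : probability T R).
Variables (I J : finType) (g : I -> J) (Y : I -> T -> R).
Hypothesis mY : forall i, measurable_fun setT (Y i).
Hypothesis iY : indep_groups P g Y.
Variables (n : nat) (pi : J -> 'I_n).

Definition rowwise (F : 'I_n -> T -> R) :=
  forall i, group_measurable g Y [pred j | pi j == i] (F i).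

Lemma chernoff_sum (F : 'I_n -> T -> R) (c a : R) : rowwise F -> 0 <= c ->
  (forall i, \int[P]_w (expR (F i w))%:E <= c%:E)%E ->
  (P [set w | (a <= \sum_i F i w)%R] <= (c ^+ n * expR (- a))%:E)%E.
Proof.
move=> rF c0 hF; apply: chernoff_bound.
  by apply: measurable_sum => i; exact: (group_measurableT mY (rF i)).
rewrite (expR_sum_indep mY iY rF (index_enum_uniq _)).
rewrite -[in leRHS](card_ord n) -prodr_const -prodEFin.
(* Comparing products factor by factor requires nonnegative factors, so nonnegativity is carried
   through the induction. *)
have [] : (fun x y : \bar R => (0 <= x)%E /\ (x <= y)%E)
  (\big[*%E/1%E]_(i < n) \int[P]_w (expR (F i w))%:E)%E
  (\big[*%E/1%E]_(i < n) c%:E)%E; last by [].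
apply: (big_ind2 (fun x y : \bar R => (0 <= x)%E /\ (x <= y)%E))
  => [|x1 x2 y1 y2 [h1 h2] [h3 h4]|i _].
- by split => //; rewrite lee_fin.
- by split; [exact: mule_ge0|exact: lee_pmul].
- by split => //; apply: integral_ge0 => w _; rewrite lee_fin expR_ge0.
Qed.

(** k is the Chernoff parameter and exp b bounds the moment of one row, so the tail estimates below
    reduce to the inequality between exponents. *)
Lemma prob_le_expR (F : 'I_n -> T -> R) (k c b a y : R) : rowwise F ->
  0 <= k -> 0 <= c ->
  (forall i, \int[P]_w (expR (k * F i w))%:E = c%:E)%E ->
  c <= expR b -> n%:R * b - k * a <= - (n%:R * y) ->
  (P [set w | (a <= \sum_i F i w)%R] <= (expR (- (n%:R * y)))%:E)%E.
Proof.
move=> rF k0 c0 hF cb h.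
have rkF : rowwise (fun i w => k * F i w).
  by move=> i; apply: measurable_funM => //; exact: rF.
have mge (G : T -> R) (x : R) : measurable_fun setT G ->
    measurable [set w | x <= G w].
  move=> mG; rewrite [X in measurable X](_ : _ = setT `&` G @^-1` `[x, +oo[).
    by apply: mG => //; exact: measurable_itv.
  by rewrite setTI; apply/seteqP; split => w /=; rewrite in_itv /= andbT.
have msum (G : 'I_n -> T -> R) : rowwise G ->
    measurable_fun setT (fun w => \sum_i G i w).
  by move=> rG; apply: measurable_sum => i; exact: (group_measurableT mY (rG i)).
apply: (@le_trans _ _ (P [set w | (k * a <= \sum_i k * F i w)%R])).
  apply: le_measure; rewrite ?inE; [exact/mge/msum|exact/mge/msum|].
  by move=> w /= aF; rewrite -big_distrr ler_wpM2l.
apply: le_trans (chernoff_sum _ rkF c0 _) _ => [i|]; first by rewrite hF.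
rewrite lee_fin; apply: (@le_trans _ _ (expR (n%:R * b) * expR (- (k * a)))).
  by rewrite ler_wpM2r ?expR_ge0 // expRM_natl lerXn2r // ?nnegrE ?expR_ge0.
by rewrite -expRD ler_expR.
Qed.

Lemma gaussian_square_sum_upper (X : 'I_n -> T -> R) (v y : R) : 0 < v ->
  0 <= y -> rowwise X -> (forall i, centered_normal_law P (X i) v) ->
  (P [set w | (n%:R * v * (1 + rate y) <= \sum_i X i w ^+ 2)%R]
     <= (expR (- (n%:R * y)))%:E)%E.
Proof.
move=> v0 y0 rX law; have [t [t0 t1 tr try]] := rate_split y0.
(* The moment is (1 - s)^(-1/2), so the exponent per row is at most s^2 - s [rate y] / 2. With s = t
   / 4 and t <= [rate y] this is at most - t [rate y] / 16 <= - y. *)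
pose s := t / 4; pose k := s / (2 * v).
have k0 : 0 <= k by rewrite divr_ge0 ?mulr_ge0 // ?ltW // divr_ge0.
have rF : rowwise (fun i w => X i w ^+ 2).
  by move=> i; exact: measurable_funX (rX i).
have s12 : s <= 2^-1 by rewrite /s; lra.
have kv : 2 * k * v = s by rewrite /k; field; rewrite gt_eqF.
apply: (prob_le_expR (k := k) rF k0 _ _ (chi2_mgf_upper _ s12)).
- by rewrite invr_ge0 sqrtr_ge0.
- by move=> i; rewrite (normal_law_mgf_sq v0 (law i)) kv //; lra.
- by rewrite divr_ge0.
have -> : k * (n%:R * v * (1 + rate y)) = n%:R * (s * (1 + rate y) / 2).
  by rewrite /k; field; rewrite gt_eqF.
rewrite -mulrBr -[leRHS]mulrN ler_wpM2l //.
by rewrite /s; nra.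
Qed.

Lemma gaussian_square_sum_lower (X : 'I_n -> T -> R) (v y : R) : 0 < v ->
  0 <= y -> rowwise X -> (forall i, centered_normal_law P (X i) v) ->
  (P [set w | (\sum_i X i w ^+ 2 <= n%:R * v * (1 - rate y))%R]
     <= (expR (- (n%:R * y)))%:E)%E.
Proof.
(* No cap here: the moments of - X^2 are finite for every positive parameter. The exponent per row
   is (t^2 - t [rate y]) / 2, that is minus the square of [rate y] over 8, which is at most - 2
   y. *)
move=> v0 y0 rX law; pose t := rate y / 2; pose k := t / (2 * v).
have t0 : 0 <= t by rewrite divr_ge0 // rate_ge0.
have k0 : 0 <= k by apply: divr_ge0 => //; rewrite mulr_ge0 // ltW.
have rF : rowwise (fun i w => - X i w ^+ 2).
  move=> i; apply: (measurableT_comp (@oppr_measurable R setT)).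
  exact: measurable_funX (rX i).
have kv : 2 * (- k) * v = - t by rewrite /k; field; rewrite gt_eqF.
have -> : [set w | (\sum_i X i w ^+ 2 <= n%:R * v * (1 - rate y))%R] =
    [set w | (- (n%:R * v * (1 - rate y)) <= \sum_i - X i w ^+ 2)%R].
  by apply/seteqP; split => w /=; rewrite sumrN lerN2.
apply: (prob_le_expR (k := k) rF k0 _ _ (chi2_mgf_lower t0)).
- by rewrite invr_ge0 sqrtr_ge0.
- move=> i; under eq_integral do rewrite mulrN -mulNr.
  by rewrite (normal_law_mgf_sq v0 (law i)) kv ?opprK //; lra.
have -> : k * - (n%:R * v * (1 - rate y)) = n%:R * (- t * (1 - rate y) / 2).
  by rewrite /k; field; rewrite gt_eqF.
rewrite -mulrBr -[leRHS]mulrN ler_wpM2l //.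
have : 16 * y <= rate y ^+ 2.
  have s0 := sqrtr_ge0 y; have sy : Num.sqrt y ^+ 2 = y by exact: sqr_sqrtr.
  by rewrite /rate -[X in 16 * X <= _]sy; nra.
by rewrite /t; nra.
Qed.

Lemma gaussian_product_sum_upper (X W : 'I_n -> T -> R) (v u y : R) :
  0 < v -> 0 < u -> 0 <= y -> rowwise X -> rowwise W ->
  (forall i, centered_normal_law P (X i) v) ->
  (forall i, centered_normal_law P (W i) u) ->
  (forall i, indep_rv P (X i) (W i)) ->
  (P [set w | (n%:R * Num.sqrt (v * u) * rate y <= \sum_i X i w * W i w)%R]
     <= (expR (- (n%:R * y)))%:E)%E.
Proof.
move=> v0 u0 y0 rX rW lawX lawW XW; have [t [t0 t1 tr try]] := rate_split y0.
have vu0 : 0 < v * u by rewrite mulr_gt0.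
(* The moment is (1 - s^2)^(-1/2), so [chi2_mgf_upper] is applied at s^2. As s <= 1/2 and s <=
   [rate y] / 2, the exponent (s^2 + 2 s^4) / 2 - s [rate y] is at most - y. *)
pose s := t / 2; pose k := s / Num.sqrt (v * u).
have q0 : 0 < Num.sqrt (v * u) by rewrite sqrtr_gt0.
have s0 : 0 <= s by rewrite divr_ge0.
have k0 : 0 <= k by rewrite divr_ge0 // ltW.
have rF : rowwise (fun i w => X i w * W i w).
  by move=> i; apply: measurable_funM; [exact: rX|exact: rW].
have s12 : s ^+ 2 <= 2^-1 by rewrite /s; nra.
have kv : k ^+ 2 * (v * u) = s ^+ 2.
  by rewrite /k expr_div_n sqr_sqrtr ?ltW // divfK // gt_eqF.
apply: (prob_le_expR (k := k) rF k0 _ _ (chi2_mgf_upper (sqr_ge0 s) s12)).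
- by rewrite invr_ge0 sqrtr_ge0.
- move=> i; rewrite (normal_law_mgf_prod v0 u0 (lawX i) (lawW i) (XW i)) kv //.
  by apply: le_lt_trans s12 _; lra.
have -> : k * (n%:R * Num.sqrt (v * u) * rate y) = n%:R * (s * rate y).
  by rewrite /k; field; rewrite gt_eqF.
rewrite -mulrBr -[leRHS]mulrN ler_wpM2l //.
by rewrite /s in s12 *; nra.
Qed.

End Tails.

(** * A deterministic criterion for the optimality of [Bstar] *)

Section Maximizer.
Context {R : realType} {p K : nat} (grp : 'I_p -> 'I_K).
Notation P := (Bstar grp : 'M[R]_p).
Hypothesis surj : forall k : 'I_K, exists a : 'I_p, grp a = k.
Variables (M N : 'M[R]_p) (c : 'I_K -> 'I_K -> R) (x : 'I_K -> 'I_p -> R).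
Variables (c0 eta lam m : R).
Hypothesis csym : forall j k, c j k = c k j.
Hypothesis ME : forall a b, M a b =
  c (grp a) (grp b) + x (grp a) b + x (grp b) a + N a b + c0 * (a == b)%:R.
Hypothesis m0 : 0 < m.
Hypothesis hm : forall k, m <= (group_size grp k)%:R.
Hypothesis Nsym : forall a b, N a b = N b a.
Hypothesis PN : forall a b, `|(P *m N) a b| <= eta.
Hypothesis lam0 : 0 <= lam.
Hypothesis qfN : forall v, qf N v <= lam * \sum_a v a ^+ 2.
Hypothesis gap : forall j b, j != grp b ->
  0 < 2^-1 * (c j j + c (grp b) (grp b) - 2 * c j (grp b))
      - 2 * (x j b - x (grp b) b) - (6 * eta + lam / m).

(** The multiple [c0] of the identity drops out because tr H = 0. The noise cost is proportional to
    [offmass], a sum of the same entries of B as the signal, so everything is collected entry by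
    entry. *)
Lemma inner_gap_ge (B : 'M[R]_p) : Cset K B ->
  \sum_b \sum_(a | grp a != grp b)
    (2^-1 * (c (grp a) (grp a) + c (grp b) (grp b) - 2 * c (grp a) (grp b))
      - 2 * (x (grp a) b - x (grp b) b) - (6 * eta + lam / m)) * B a b
  <= inner M (P - B).
Proof.
move=> BC; have [tB _ _ _ trB] := BC; set H := P - B.
have Hsym a b : H a b = H b a.
  have HE e f : H e f = P e f - B e f by rewrite /H mxE [(- B) e f]mxE.
  by rewrite !HE BstarC; congr (_ - _); rewrite -{1}tB mxE.
have -> : inner M H = \sum_a \sum_b c (grp a) (grp b) * H a b
    + (\sum_a \sum_b x (grp a) b * H a b) *+ 2 + inner N H + c0 * \tr H.
  have -> : (\sum_a \sum_b x (grp a) b * H a b) *+ 2 =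
      \sum_a \sum_b x (grp a) b * H a b + \sum_a \sum_b x (grp b) a * H a b.
    rewrite mulr2n; congr (_ + _); rewrite exchange_big.
    by apply: eq_bigr => a _; apply: eq_bigr => b _; rewrite Hsym.
  rewrite !innerE /mxtrace big_distrr -!big_split; apply: eq_bigr => a _ /=.
  have -> : c0 * H a a = \sum_b c0 * (a == b)%:R * H a b.
    rewrite (bigD1 a) //= eqxx mulr1 big1 ?addr0 // => b.
    by rewrite eq_sym => /negbTE ->; rewrite mulr0 mul0r.
  by rewrite -!big_split; apply: eq_bigr => b _ /=; rewrite ME; ring.
have -> : \tr H = 0 by rewrite linearB /= Bstar_trace // trB subrr.
rewrite mulr0 addr0 inner_signal // inner_cross //.
have := inner_noise_ge surj BC m0 hm Nsym PN lam0 qfN; rewrite -/H => hN.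
set k := 6 * eta + lam / m; set L := leLHS; set D := \sum_b _; set X := \sum_b _.
apply: (@le_trans _ _ (2^-1 * D - 2 * X - k * offmass grp B)); last by rewrite -/k in hN; lra.
rewrite /L /D /X /offmass !big_distrr /= -!sumrB; apply: ler_sum => b _.
rewrite !big_distrr /= -!sumrB; apply: ler_sum => a _.
by rewrite le_eqVlt; apply/orP; left; apply/eqP; ring.
Qed.

(** All coefficients outside the blocks are positive, so a lower bound equal to 0 would give
    [offmass] = 0, hence B = P. *)
Lemma Bstar_unique_maximizer : unique_maximizer K M P.
Proof.
split; first exact: Bstar_Cset.
move=> B BC nBP.
have innerB : inner M (P - B) = inner M P - inner M B.
  by rewrite /inner mulmxBr linearB.
rewrite -subr_gt0 -innerB; apply: lt_le_trans (inner_gap_ge BC).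
have B0 a b : 0 <= B a b by case: BC.
have off0 : 0 < offmass grp B.
  rewrite lt_neqAle (offmass_ge0 grp BC) andbT eq_sym.
  by apply/eqP => /(offmass_eq0 surj BC).
rewrite lt_neqAle; apply/andP; split; last first.
  apply: sumr_ge0 => b _; apply: sumr_ge0 => a ab.
  by rewrite mulr_ge0 // ltW // gap.
apply/eqP => /esym/eqP; rewrite psumr_eq0 => [|b _]; last first.
  apply: sumr_ge0 => a ab; by rewrite mulr_ge0 // ltW // gap.
move=> /allP s0; move: off0; rewrite /offmass big1 ?ltxx // => b _.
have := s0 b (mem_index_enum _); rewrite /= psumr_eq0 => [|a ab]; last first.
  by rewrite mulr_ge0 // ltW // gap.
move=> /allP s1; rewrite big1 // => a ab.
have := s1 a (mem_index_enum _); rewrite ab /= mulf_eq0.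
by rewrite gt_eqF ?gap //= => /eqP.
Qed.

End Maximizer.

(** * Optimality of B^* on the good event *)

Section GoodEvent.
Context {R : realType} {n p K : nat} (grp : 'I_p -> 'I_K).
Notation P := (Bstar grp : 'M[R]_p).

Definition noise_var (gam : 'I_K -> R) (v : 'I_p -> R) : R :=
  \sum_a gam (grp a) * v a ^+ 2.

Definition noise_square (E : 'I_n -> 'I_p -> R) (v : 'I_p -> R) : R :=
  \sum_i (\sum_a v a * E i a) ^+ 2.

(* Polarizing along these vectors recovers the entries of [Bstar *m W]. *)
Definition probe (a b : 'I_p) (s : bool) : 'I_p -> R :=
  fun c => (if grp c == grp a then (Num.sqrt (group_size grp (grp a))%:R)^-1 else 0)
    + (if c == b then (-1) ^+ s else 0).

Definition unit_vector (a : 'I_p) : 'I_p -> R := fun c => if c == a then 1 else 0.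

Definition signal_gap (C : 'M[R]_K) j k : R := C j j + C k k - 2 * C j k.

(** Level [r1] is for families of polynomial size, [r2] for the integer points. [good_unit] also has
    [r2]: it supplies the curvature bound [mu] of the rounding, which is added to the lattice
    bound. *)
Record good_event (C : 'M[R]_K) (gam : 'I_K -> R) (G : 'M[R]_p)
  (Z : 'I_n -> 'I_K -> R) (E : 'I_n -> 'I_p -> R) (delta r1 r2 : R) : Prop := {
  good_diag : varnorm (G - Gamma_of grp gam) <= delta;
  good_signal : forall j k, j != k ->
    n%:R * signal_gap C j k * (1 - r1) <= \sum_i (Z i j - Z i k) ^+ 2;
  good_cross : forall j b, j != grp b ->
    \sum_i (Z i j - Z i (grp b)) * E i b <=
    n%:R * Num.sqrt (signal_gap C j (grp b) * gam (grp b)) * r1;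
  good_probe_lower : forall a b s,
    n%:R * noise_var gam (probe a b s) * (1 - r1) <= noise_square E (probe a b s);
  good_probe_upper : forall a b s,
    noise_square E (probe a b s) <= n%:R * noise_var gam (probe a b s) * (1 + r1);
  good_lattice : forall f : lattice_index p, lattice_ball f ->
    noise_square E (fun a => (lattice_point f a)%:~R) <=
    n%:R * noise_var gam (fun a => (lattice_point f a)%:~R) * (1 + r2);
  good_unit : forall a,
    n%:R * noise_var gam (unit_vector a) * (1 - r2) <= noise_square E (unit_vector a)
}.

Section Noise.
Variables (gam : 'I_K -> R) (E : 'I_n -> 'I_p -> R) (S : R).
Hypothesis n0 : (0 < n)%N.
Hypothesis S0 : 0 <= S.
Hypothesis gamS : forall k, gam k <= S.

Definition noise_dev : 'M[R]_p :=
  \matrix_(a, b) (n%:R^-1 * \sum_i E i a * E i b - Gamma_of grp gam a b).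

Lemma noise_devC a b : noise_dev a b = noise_dev b a.
Proof.
rewrite !mxE; congr (_ * _ - _).
  by apply: eq_bigr => i _; rewrite mulrC.
by rewrite eq_sym; case: eqP => // ->.
Qed.

Lemma qf_noise_dev v :
  qf noise_dev v = n%:R^-1 * noise_square E v - noise_var gam v.
Proof.
transitivity (n%:R^-1 * \sum_a \sum_b (\sum_i E i a * E i b) * (v a * v b)
    - \sum_a \sum_b Gamma_of grp gam a b * (v a * v b)).
  rewrite /qf big_distrr -sumrB; apply: eq_bigr => a _.
  rewrite /= big_distrr -sumrB; apply: eq_bigr => b _.
  by rewrite [noise_dev a b]mxE /=; ring.
congr (_ * _ - _).
  under eq_bigr do under eq_bigr do rewrite big_distrl.
  under eq_bigr do rewrite exchange_big.
  rewrite exchange_big /=; apply: eq_bigr => i _.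
  rewrite expr2 big_distrl /=; apply: eq_bigr => a _.
  by rewrite big_distrr; apply: eq_bigr => b _ /=; ring.
apply: eq_bigr => a _; rewrite (bigD1 a) //= big1 => [|b].
  by rewrite mxE eqxx; ring.
by rewrite mxE eq_sym => /negbTE ->; rewrite mul0r.
Qed.

Lemma noise_var_le v : noise_var gam v <= S * \sum_a v a ^+ 2.
Proof.
rewrite /noise_var big_distrr; apply: ler_sum => a _.
by rewrite ler_wpM2r // sqr_ge0.
Qed.

Let nR0 : 0 < n%:R :> R. Proof. by rewrite ltr0n. Qed.

Lemma qf_noise_dev_le v r : 0 <= r ->
  noise_square E v <= n%:R * noise_var gam v * (1 + r) ->
  qf noise_dev v <= S * r * \sum_a v a ^+ 2.
Proof.
move=> r0 h; rewrite qf_noise_dev.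
have : n%:R^-1 * noise_square E v <= noise_var gam v * (1 + r).
  by rewrite mulrC ler_pdivrMr // mulrC mulrA.
have : noise_var gam v * r <= S * r * \sum_a v a ^+ 2.
  by rewrite mulrAC ler_wpM2r // noise_var_le.
by lra.
Qed.

Lemma qf_noise_dev_ge v r : 0 <= r ->
  n%:R * noise_var gam v * (1 - r) <= noise_square E v ->
  - (S * r * \sum_a v a ^+ 2) <= qf noise_dev v.
Proof.
move=> r0 h; rewrite qf_noise_dev.
have : noise_var gam v * (1 - r) <= n%:R^-1 * noise_square E v.
  by rewrite [leRHS]mulrC ler_pdivlMr // mulrC mulrA.
have : noise_var gam v * r <= S * r * \sum_a v a ^+ 2.
  by rewrite mulrAC ler_wpM2r // noise_var_le.
by lra.
Qed.

Lemma probe_norm a b s : \sum_c probe a b s c ^+ 2 <= 4.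
Proof.
set g := (group_size grp (grp a))%:R : R.
have g0 : 0 < g by rewrite ltr0n group_size_gt0.
pose f c : R := if grp c == grp a then (Num.sqrt g)^-1 else 0.
pose e c : R := if c == b then (-1) ^+ s else 0.
apply: (@le_trans _ _ (\sum_c (2 * f c ^+ 2 + 2 * e c ^+ 2))).
  apply: ler_sum => c _; rewrite /probe -/g -/(f c) -/(e c).
  by have := sqr_ge0 (f c - e c); lra.
rewrite big_split /= -!big_distrr /=.
have -> : \sum_c f c ^+ 2 = 1.
  rewrite (bigID (fun c => grp c == grp a)) /= [X in _ + X]big1 ?addr0.
    rewrite (eq_bigr (fun=> g^-1)) => [|c ca].
      by rewrite sum_group_cst mulVf // gt_eqF.
    by rewrite /f ca exprVn sqr_sqrtr // ltW.
  by move=> c ca; rewrite /f (negbTE ca) expr0n.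
have -> : \sum_c e c ^+ 2 = 1.
  rewrite (bigD1 b) //= /e eqxx sqrr_sign big1 ?addr0 // => c /negbTE ->.
  by rewrite expr0n.
by lra.
Qed.

(** Polarization: the two forms differ by 4 f^t N e_b, with f the indicator of the group of a
    divided by sqrt g, and this is 4 sqrt g times the entry. Division by sqrt g is the gain from
    averaging. *)
Lemma Bstar_noise_dev_probe a b :
  (P *m noise_dev) a b = (4 * Num.sqrt (group_size grp (grp a))%:R)^-1 *
    (qf noise_dev (probe a b false) - qf noise_dev (probe a b true)).
Proof.
set g := (group_size grp (grp a))%:R : R.
have g0 : 0 < g by rewrite ltr0n group_size_gt0.
have q0 : 0 < Num.sqrt g by rewrite sqrtr_gt0.
rewrite mxE Bstar_mean -/g /probe -/g !qf_add_delta; try exact: noise_devC.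
pose f c : R := if grp c == grp a then (Num.sqrt g)^-1 else 0.
have -> : \sum_c noise_dev b c * f c =
    (Num.sqrt g)^-1 * \sum_(c | grp c == grp a) noise_dev c b.
  rewrite big_distrr [RHS]big_mkcond /=; apply: eq_bigr => c _.
  by rewrite /f; case: ifP; rewrite ?mulr0 // mulrC noise_devC.
rewrite -{1}[g]sqr_sqrtr ?ltW //; set q := Num.sqrt g in q0 *.
set X := \sum_(c | _) _; set Y := qf _ _.
by rewrite /= expr0 expr1; field; rewrite gt_eqF.
Qed.

End Noise.

Lemma varnorm_ge (D : 'M[R]_p) a b : D a a - D b b <= varnorm D.
Proof.
rewrite /varnorm; apply: le_trans (le_bigmax _ _ a) => /=.
exact: (@le_bigmax _ _ _ 0 (fun b => D a a - D b b) b).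
Qed.

Section Deterministic.
Variables (C : 'M[R]_K) (gam : 'I_K -> R) (G : 'M[R]_p).
Variables (Z : 'I_n -> 'I_K -> R) (E : 'I_n -> 'I_p -> R).
Variables (delta r1 r2 S m : R).
Hypothesis surj : forall k : 'I_K, exists a : 'I_p, grp a = k.
Hypothesis n0 : (0 < n)%N.
Hypothesis p0 : (0 < p)%N.
Hypothesis S0 : 0 <= S.
Hypothesis gamS : forall k, gam k <= S.
Hypothesis r10 : 0 <= r1.
Hypothesis r20 : 0 <= r2.
Hypothesis delta0 : 0 <= delta.
Hypothesis m1 : 1 <= m.
Hypothesis hm : forall k, m <= (group_size grp k)%:R.
Hypothesis dG : is_diag_mx G.
Hypothesis good : good_event C gam G Z E delta r1 r2.

(** In [eta], two probe forms of size at most 4 S [r1] are subtracted and divided by 4 sqrt m. In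
    [lam], the 5 is 4 from the squared radius 4 p of the lattice ball plus 1 from the rounding. The
    terms in [delta] come from the diagonal error. *)
Let eta := 2 * S * r1 / Num.sqrt m + delta / m.
Let lam := 5 * S * r2 + delta.

Hypothesis gap : forall j b, j != grp b ->
  0 < 2^-1 * (signal_gap C j (grp b) * (1 - r1))
    - 2 * (Num.sqrt (signal_gap C j (grp b) * gam (grp b)) * r1)
    - (6 * eta + lam / m).

Lemma good_event_maximizer :
  unique_maximizer K
    (Sigmahat (\matrix_(i, a) (Z i (grp a) + E i a)) - G) P.
Proof.
have nR0 : 0 < n%:R :> R by rewrite ltr0n.
have m0 : 0 < m by exact: lt_le_trans ltr01 m1.
pose a0 := Ordinal p0.
pose D : 'M[R]_p := Gamma_of grp gam - G.
(* Any diagonal entry can serve as reference: the multiple [c0] of the identity is free, and |.|_V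
   bounds what remains by [delta]. *)
pose c0 := D a0 a0.
have Ddiag a b : a != b -> D a b = 0.
  move=> ab; rewrite mxE [(- G) a b]mxE [Gamma_of _ _ _ _]mxE (negbTE ab) sub0r.
  by move/is_diag_mxP : dG => -> //; rewrite oppr0.
have Dabs a : `|D a a - c0| <= delta.
  have DE b c : D b b - D c c = (G - Gamma_of grp gam) c c - (G - Gamma_of grp gam) b b.
    have ON e : D e e = - (G - Gamma_of grp gam) e e by rewrite /D -opprB [LHS]mxE.
    by rewrite !ON opprK addrC.
  rewrite ler_norml lerNl opprB !DE; apply/andP.
  by split; apply: le_trans (good_diag good); exact: varnorm_ge.
pose N : 'M[R]_p := noise_dev gam E + (D - c0%:M).
have NE a b : N a b = noise_dev gam E a b + (D a b - c0 * (a == b)%:R).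
  by rewrite !mxE mulr_natr.
have Nsym a b : N a b = N b a.
  rewrite !NE noise_devC eq_sym; have [->//|ab] := eqVneq a b.
  by rewrite !Ddiag // eq_sym.
apply: (@Bstar_unique_maximizer R p K grp surj _ N
  (fun j k => n%:R^-1 * \sum_i Z i j * Z i k)
  (fun j b => n%:R^-1 * \sum_i Z i j * E i b) c0 eta lam m) => //.
- by move=> j k; congr (_ * _); apply: eq_bigr => i _; rewrite mulrC.
- move=> a b; rewrite NE !mxE.
  rewrite (_ : \sum_j _ = \sum_i Z i (grp a) * Z i (grp b)
     + \sum_i Z i (grp a) * E i b + \sum_i Z i (grp b) * E i a
     + \sum_i E i a * E i b); last first.
    by rewrite -!big_split; apply: eq_bigr => i _; rewrite !mxE /=; ring.
  by ring.
- have DE a b : (D - c0%:M) a b = D a b - c0 * (a == b)%:R.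
    by rewrite !mxE mulr_natr.
  have PD a b : `|(P *m (D - c0%:M)) a b| <= delta / m.
    rewrite mxE (bigD1 b) //= big1 => [|c cb]; last first.
      by rewrite DE Ddiag // (negbTE cb) mulr0 subr0 mulr0.
    rewrite addr0 DE eqxx mulr1.
    rewrite normrM (ger0_norm (Bstar_ge0 _ _ _)) mulrC ler_pM ?Bstar_ge0 //.
    rewrite mxE; case: ifP => _; last by rewrite invr_ge0 ltW.
    by rewrite lef_pV2 ?posrE // ltr0n group_size_gt0.
  move=> a b; rewrite mulmxDr mxE (le_trans (ler_normD _ _)) // lerD //.
  rewrite Bstar_noise_dev_probe.
  have b4 s : S * r1 * \sum_c probe a b s c ^+ 2 <= S * r1 * 4.
    by rewrite ler_wpM2l ?probe_norm // mulr_ge0.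
  have u s := le_trans (qf_noise_dev_le n0 gamS r10 (good_probe_upper good a b s)) (b4 s).
  have l s : - (S * r1 * 4) <= qf (noise_dev gam E) (probe a b s).
    apply: le_trans (qf_noise_dev_ge n0 gamS r10 (good_probe_lower good a b s)).
    by rewrite lerN2 b4.
  set g := (group_size grp (grp a))%:R : R.
  have q0 : 0 < Num.sqrt m by rewrite sqrtr_gt0.
  have qg : Num.sqrt m <= Num.sqrt g by apply: ler_wsqrtr; exact: hm.
  have qg0 := lt_le_trans q0 qg.
  have h : `|qf (noise_dev gam E) (probe a b false) - qf (noise_dev gam E) (probe a b true)|
      <= 8 * (S * r1).
    have := u true; have := u false; have := l true; have := l false.
    rewrite ler_norml; move=> *; apply/andP; split; lra.
  have i0 : 0 <= (4 * Num.sqrt g)^-1 by rewrite invr_ge0 mulr_ge0 // ltW.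
  rewrite normrM (ger0_norm i0).
  apply: (@le_trans _ _ ((4 * Num.sqrt m)^-1 * (8 * (S * r1)))).
    by apply: ler_pM => //; rewrite lef_pV2 ?posrE ?mulr_gt0 // ler_pM2l.
  by rewrite le_eqVlt; apply/orP; left; apply/eqP; field; rewrite gt_eqF.
- by rewrite addr_ge0 // !mulr_ge0.
- move=> v.
  have -> : qf N v = qf (noise_dev gam E) v + \sum_a (D a a - c0) * v a ^+ 2.
    rewrite /qf -big_split; apply: eq_bigr => a _ /=.
    under eq_bigr do rewrite NE mulrDl; rewrite big_split /=; congr (_ + _).
    rewrite (bigD1 a) //= eqxx mulr1 -expr2 big1 ?addr0 // => b ba.
    have ab : a != b by rewrite eq_sym.
    by rewrite Ddiag // (negbTE ab) mulr0 subr0 mul0r.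
  have hD : \sum_a (D a a - c0) * v a ^+ 2 <= delta * \sum_a v a ^+ 2.
    rewrite big_distrr; apply: ler_sum => a _; rewrite ler_wpM2r ?sqr_ge0 //.
    exact: le_trans (ler_norm _) (Dabs a).
  have hW : qf (noise_dev gam E) v <= (S * r2 * 4 + S * r2) * \sum_a v a ^+ 2.
    apply: qf_le_lattice => //.
    + exact: noise_devC.
    + by rewrite mulr_ge0.
    + move=> a; rewrite -(qf_delta (noise_dev gam E) a).
      have := qf_noise_dev_ge n0 gamS r20 (good_unit good a).
      rewrite (bigD1 a) //= big1 => [|b /negbTE ba]; last by rewrite /unit_vector ba expr0n.
      by rewrite /unit_vector eqxx expr1n addr0 mulr1.
    + move=> z hz; have [f fb fz] := lattice_pointP hz.
      have := qf_noise_dev_le n0 gamS r20 (good_lattice good fb).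
      rewrite fz => /le_trans; apply; rewrite -[leRHS]mulrA -natrM.
      by rewrite ler_wpM2l // mulr_ge0.
  by rewrite /lam; lra.
- move=> j b jb; apply: lt_le_trans (gap jb) _.
  have sj : signal_gap C j (grp b) * (1 - r1) <= n%:R^-1 * \sum_i (Z i j - Z i (grp b)) ^+ 2.
    by rewrite [leRHS]mulrC ler_pdivlMr // mulrC mulrA (good_signal good jb).
  have cj : n%:R^-1 * \sum_i (Z i j - Z i (grp b)) * E i b <=
      Num.sqrt (signal_gap C j (grp b) * gam (grp b)) * r1.
    by rewrite mulrC ler_pdivrMr // mulrC mulrA (good_cross good jb).
  have e1 : n%:R^-1 * \sum_i (Z i j - Z i (grp b)) ^+ 2 =
     n%:R^-1 * (\sum_i Z i j * Z i j) + n%:R^-1 * (\sum_i Z i (grp b) * Z i (grp b))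
     - 2 * (n%:R^-1 * \sum_i Z i j * Z i (grp b)).
    rewrite mulrCA -!mulrDr -mulrBr; congr (_ * _); rewrite big_distrr -big_split -sumrB.
    by apply: eq_bigr => i _ /=; ring.
  have e2 : n%:R^-1 * \sum_i (Z i j - Z i (grp b)) * E i b =
     n%:R^-1 * (\sum_i Z i j * E i b) - n%:R^-1 * (\sum_i Z i (grp b) * E i b).
    rewrite -mulrBr; congr (_ * _); rewrite -sumrB.
    by apply: eq_bigr => i _ /=; ring.
  by rewrite -e1 -e2; lra.
Qed.

End Deterministic.
End GoodEvent.

(** * Numerical constants in the separation condition *)

Section Numeric.
Context {R : realType}.
Variables (n p m S delta L : R).
Hypothesis n0 : 0 < n.
Hypothesis p0 : 0 <= p.
Hypothesis m1 : 1 <= m.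
Hypothesis S0 : 0 <= S.
Hypothesis delta0 : 0 <= delta.
Hypothesis L0 : 0 <= L.
Hypothesis Ln : L <= 1000^-1 * n.

Definition threshold : R :=
  S * (Num.sqrt (L / (m * n)) + Num.sqrt (p / (n * m ^+ 2)) + L / n + p / (n * m))
  + delta / m.

Let m0 : 0 < m. Proof. exact: lt_le_trans ltr01 m1. Qed.

Lemma sqrt_le_mul (k a b : R) : 0 <= k -> 0 <= b -> a <= k ^+ 2 * b ->
  Num.sqrt a <= k * Num.sqrt b.
Proof.
move=> k0 b0 h; apply: le_trans (ler_wsqrtr h) _.
by rewrite sqrtrM ?sqr_ge0 // sqrtr_sqr ger0_norm.
Qed.

(** The four rates receive 6 * 2 * 8 = 96, 5 * 12 = 60, 6 * 2 * 48 = 576 and 5 * 128 = 640, and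
    delta / m receives 7; the largest is 640. The roots of 3 and 8 are rounded up to 2 and 3. *)
Lemma noise_threshold :
  6 * (2 * S * rate (3 * L / n) / Num.sqrt m + delta / m)
    + (5 * S * rate (8 * p / n) + delta) / m <= 640 * threshold.
Proof.
set u := Num.sqrt (L / (m * n)); set v := Num.sqrt (p / (n * m ^+ 2)).
have u0 : 0 <= u by exact: sqrtr_ge0.
have v0 : 0 <= v by exact: sqrtr_ge0.
have a0 : 0 <= L / n by rewrite divr_ge0 // ltW.
have b0 : 0 <= p / (n * m) by rewrite divr_ge0 // mulr_ge0 // ltW.
have d0 : 0 <= delta / m by rewrite divr_ge0 // ltW.
have q1 : 1 <= Num.sqrt m by rewrite -sqrtr1 ler_wsqrtr.
have q0 : 0 < Num.sqrt m by exact: lt_le_trans ltr01 q1.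
have h1 : rate (3 * L / n) / Num.sqrt m <= 8 * u + 48 * (L / n).
  rewrite /rate mulrDl lerD //.
    rewrite ler_pdivrMr // -[8 * u * _]mulrA.
    have -> : 8 * (u * Num.sqrt m) = 8 * Num.sqrt (L / n).
      rewrite -sqrtrM ?divr_ge0 ?mulr_ge0 // ?ltW //; congr (_ * Num.sqrt _).
      by field; rewrite !gt_eqF.
    have h3 : 3 * L / n <= 2 ^+ 2 * (L / n) by lra.
    by have := sqrt_le_mul (ler0n _ 2) a0 h3; lra.
  rewrite ler_pdivrMr //; apply: (@le_trans _ _ (48 * (L / n) * 1)); first lra.
  by rewrite ler_wpM2l // mulr_ge0.
have h2 : rate (8 * p / n) / m <= 12 * v + 128 * (p / (n * m)).
  rewrite /rate mulrDl lerD //; last first.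
    by rewrite le_eqVlt; apply/orP; left; apply/eqP; field; rewrite !gt_eqF.
  rewrite ler_pdivrMr //.
  have -> : 12 * v * m = 12 * Num.sqrt (p / n).
    have em : m = Num.sqrt (m ^+ 2) by rewrite sqrtr_sqr ger0_norm // ltW.
    rewrite -mulrA [X in v * X]em -sqrtrM.
      by congr (_ * Num.sqrt _); field; rewrite !gt_eqF.
    by rewrite divr_ge0 // mulr_ge0 ?sqr_ge0 // ltW.
  have pn0 : 0 <= p / n by rewrite divr_ge0 // ltW.
  have h3 : 8 * p / n <= 3 ^+ 2 * (p / n) by lra.
  by have := sqrt_le_mul (ler0n _ 3) pn0 h3; lra.
have e1 : 2 * S * rate (3 * L / n) / Num.sqrt m = 2 * S * (rate (3 * L / n) / Num.sqrt m).
  by rewrite mulrA.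
have e2 : (5 * S * rate (8 * p / n) + delta) / m = 5 * S * (rate (8 * p / n) / m) + delta / m.
  by rewrite mulrDl mulrA.
rewrite e1 e2 /threshold -/u -/v.
have h3 : 2 * S * (rate (3 * L / n) / Num.sqrt m) <= 2 * S * (8 * u + 48 * (L / n)).
  by rewrite ler_wpM2l // mulr_ge0.
have h4 : 5 * S * (rate (8 * p / n) / m) <= 5 * S * (12 * v + 128 * (p / (n * m))).
  by rewrite ler_wpM2l // mulr_ge0.
have := mulr_ge0 S0 u0; have := mulr_ge0 S0 v0; have := mulr_ge0 S0 a0.
have := mulr_ge0 S0 b0; lra.
Qed.

(** Budget: L / n <= 1/1000 gives sqrt y <= 1/16, hence [rate y] <= 1/2, and the signal keeps D / 4.
    The cross term costs at most D / 10 and the noise at most (640 / 40000) D, together less than D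
    / 4. *)
Lemma signal_threshold (D gam : R) : 0 < D -> 0 <= gam -> gam <= S ->
  200 * 200 * threshold <= D ->
  0 < 2^-1 * (D * (1 - rate (3 * L / n)))
    - 2 * (Num.sqrt (D * gam) * rate (3 * L / n))
    - (6 * (2 * S * rate (3 * L / n) / Num.sqrt m + delta / m)
    + (5 * S * rate (8 * p / n) + delta) / m).
Proof.
move=> D0 g0 gS hD; have hN := noise_threshold.
set y := 3 * L / n in hN *.
have a0 : 0 <= L / n by rewrite divr_ge0 // ltW.
have y0 : 0 <= y by rewrite /y -mulrA mulr_ge0.
have Ln' : L / n <= 1000^-1 by rewrite ler_pdivrMr.
have sy : Num.sqrt y <= 16^-1.
  rewrite -[leRHS](ger0_norm (_ : 0 <= 16^-1)) ?invr_ge0 // -sqrtr_sqr.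
  by apply: ler_wsqrtr; rewrite /y; lra.
have s0 := sqrtr_ge0 y; have s2 : Num.sqrt y ^+ 2 = y by exact: sqr_sqrtr.
have r5 : rate y <= 5 * Num.sqrt y.
  by rewrite /rate -[X in 16 * X]s2; nra.
have r1 : rate y <= 2^-1 by lra.
have t0 : S * (L / n) <= threshold.
  have u0 := sqrtr_ge0 (L / (m * n)); have v0 := sqrtr_ge0 (p / (n * m ^+ 2)).
  have b0 : 0 <= p / (n * m) by rewrite divr_ge0 // mulr_ge0 // ltW.
  have d0 : 0 <= delta / m by rewrite divr_ge0 // ltW.
  rewrite /threshold.
  have := mulr_ge0 S0 u0; have := mulr_ge0 S0 v0; have := mulr_ge0 S0 b0; lra.
have gt0 : gam * (L / n) <= threshold by apply: le_trans t0; rewrite ler_wpM2r.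
have cr : Num.sqrt (D * gam) * Num.sqrt y <= 100^-1 * D.
  have hh : Num.sqrt (D * gam * y) <= Num.sqrt ((100^-1 * D) ^+ 2).
    apply: ler_wsqrtr; rewrite expr2.
    have -> : D * gam * y = D * (3 * (gam * (L / n))) by rewrite /y; ring.
    have -> : 100^-1 * D * (100^-1 * D) = D * (100^-1 * 100^-1 * D) by ring.
    rewrite ler_wpM2l ?ltW //; lra.
  have Dg : 0 <= D * gam by rewrite mulr_ge0 // ltW.
  have D1 : 0 <= 100^-1 * D by rewrite mulr_ge0 // ltW.
  by move: hh; rewrite (sqrtrM y Dg) sqrtr_sqr ger0_norm.
have cr2 : Num.sqrt (D * gam) * rate y <= 20^-1 * D.
  apply: (@le_trans _ _ (Num.sqrt (D * gam) * (5 * Num.sqrt y))).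
    by rewrite ler_wpM2l // sqrtr_ge0.
  lra.
have sg : D * 2^-1 <= D * (1 - rate y) by rewrite ler_wpM2l ?ltW //; lra.
lra.
Qed.

End Numeric.

(** * Probability of the good event *)

Section UnionBound.
Context {R : realType} d (T : measurableType d) (P : probability T R).

Lemma measurable_lt_set (F : T -> R) (a : R) : measurable_fun setT F ->
  measurable [set w | F w < a].
Proof.
move=> mF; rewrite [X in measurable X](_ : _ = setT `&` F @^-1` `]-oo, a[).
  by apply: mF => //; exact: measurable_itv.
by rewrite setTI; apply/seteqP; split => w /=; rewrite in_itv.
Qed.

Lemma measurable_gt_set (F : T -> R) (a : R) : measurable_fun setT F ->
  measurable [set w | a < F w].
Proof.
move=> mF; rewrite [X in measurable X](_ : _ = setT `&` F @^-1` `]a, +oo[).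
  by apply: mF => //; exact: measurable_itv.
by rewrite setTI; apply/seteqP; split => w /=; rewrite in_itv /= andbT.
Qed.

Lemma measurable_le_set (F : T -> R) (a : R) : measurable_fun setT F ->
  measurable [set w | F w <= a].
Proof.
move=> mF; rewrite [X in measurable X](_ : _ = setT `&` F @^-1` `]-oo, a]).
  by apply: mF => //; exact: measurable_itv.
by rewrite setTI; apply/seteqP; split => w /=; rewrite in_itv.
Qed.

Lemma measurable_ge_set (F : T -> R) (a : R) : measurable_fun setT F ->
  measurable [set w | a <= F w].
Proof.
move=> mF; rewrite [X in measurable X](_ : _ = setT `&` F @^-1` `[a, +oo[).
  by apply: mF => //; exact: measurable_itv.
by rewrite setTI; apply/seteqP; split => w /=; rewrite in_itv /= andbT.
Qed.

Definition bad_union (X : finType) (Q : pred X) (B : X -> set T) : set T :=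
  \big[setU/set0]_(x | Q x) B x.

Lemma bad_union_measurable (X : finType) (Q : pred X) (B : X -> set T) :
  (forall x, Q x -> measurable (B x)) -> measurable (bad_union Q B).
Proof. by move=> mB; exact: bigsetU_measurable. Qed.

Lemma notin_bad_union (X : finType) (Q : pred X) (B : X -> set T) w :
  ~ bad_union Q B w -> forall x, Q x -> ~ B x w.
Proof. by move=> h x Qx Bx; apply: h; rewrite /bad_union (bigD1 x) //; left. Qed.

Lemma prob_bad_union (X : finType) (Q : pred X) (B : X -> set T) (q r : R) :
  (forall x, Q x -> measurable (B x)) ->
  (forall x, Q x -> (P (B x) <= q%:E)%E) -> #|Q|%:R * q <= r ->
  (P (bad_union Q B) <= r%:E)%E.
Proof.
move=> mB hB hr; apply: (@le_trans _ _ (\sum_(x | Q x) q%:E)%E); last first.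
  rewrite sumEFin lee_fin sumr_const; apply: le_trans hr.
  by rewrite mulr_natl.
rewrite /bad_union.
suff [] : measurable (\big[setU/set0]_(x | Q x) B x) /\
  (P (\big[setU/set0]_(x | Q x) B x) <= \sum_(x | Q x) q%:E)%E by [].
apply: (big_ind2 (fun (A : set T) (y : \bar R) => measurable A /\ (P A <= y)%E)).
- by split => //; rewrite measure0.
- move=> A1 y1 A2 y2 [mA1 h1] [mA2 h2]; split; first exact: measurableU.
  by apply: le_trans (measureU2 _ mA1 mA2) _; exact: leeD.
- by move=> x Qx; split; [exact: mB|exact: hB].
Qed.

End UnionBound.

(** * The Gaussian events in the latent model *)

Section Model.
Context {R : realType} d (T : measurableType d) (P : probability T R).
Variables (n p K : nat) (grp : 'I_p -> 'I_K) (C : 'M[R]_K) (gam : 'I_K -> R).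
Variables (Z : 'I_n -> 'I_K -> T -> R) (E : 'I_n -> 'I_p -> T -> R).
Hypothesis Csym : C^T = C.
Hypothesis gam0 : forall k, 0 < gam k.
Hypothesis model : GLatentModel P grp C gam Z E.

Notation g := (@latent_group n K p).
Notation Y := (latent_var Z E).

Let mY x : measurable_fun setT (Y x).
Proof.
case: model => mZ mE _ _ _; case: x => i [k|a]; [exact: mZ|exact: mE].
Qed.

Let iY : indep_groups P g Y. Proof. by case: model. Qed.

Definition signal_diff j k i w := Z i j w - Z i k w.
Definition noise_comb (v : 'I_p -> R) i w := \sum_a v a * E i a w.

Let groupZ j k i : group_measurable g Y [pred x | x == (i, false)] (signal_diff j k i).
Proof.
apply: measurable_funB.
  by apply: (group_measurable_var (i := (i, inl j) : latent_index n K p)) => /=.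
by apply: (group_measurable_var (i := (i, inl k) : latent_index n K p)) => /=.
Qed.

Let groupE v i : group_measurable g Y [pred x | x == (i, true)] (noise_comb v i).
Proof.
apply: measurable_sum => a; apply: measurable_funM => //.
by apply: (group_measurable_var (i := (i, inr a) : latent_index n K p)) => /=.
Qed.

Let rowZ j k : rowwise g Y fst (signal_diff j k).
Proof. by move=> i; apply: (group_measurableS _ (@groupZ j k i)) => x /= /eqP ->. Qed.

Let rowE v : rowwise g Y fst (noise_comb v).
Proof. by move=> i; apply: (group_measurableS _ (@groupE v i)) => x /= /eqP ->. Qed.

Let ZE_indep j k v i : indep_rv P (signal_diff j k i) (noise_comb v i).
Proof.
by apply: (group_measurable_indep mY iY _ (@groupZ j k i) (@groupE v i)) => x /=
  /eqP ->; rewrite xpair_eqE andbF.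
Qed.

Let Cjk j k : C j k = C k j. Proof. by rewrite -{1}Csym mxE. Qed.

Let lawZ j k i : centered_normal_law P (signal_diff j k i) (signal_gap C j k).
Proof.
case: model => _ _ _ lawZ _.
pose u l : R := (l == j)%:R - (l == k)%:R.
have uE (F : 'I_K -> R) : \sum_l u l * F l = F j - F k.
  rewrite /u; under eq_bigr do rewrite mulrBl.
  rewrite sumrB (bigD1 j) //= eqxx mul1r big1 => [|l /negbTE ->]; last by rewrite mul0r.
  rewrite (bigD1 k) //= eqxx mul1r big1 => [|l /negbTE ->]; last by rewrite mul0r.
  by rewrite !addr0.
have := lawZ i u; congr (centered_normal_law P _ _).
  by apply/funext => w; rewrite uE.
rewrite (eq_bigr (fun l => u l * (C l j - C l k))) => [|l _]; last first.
  by rewrite -uE big_distrr; apply: eq_bigr => l' _ /=; ring.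
by rewrite uE /signal_gap (Cjk k j); ring.
Qed.

Let lawE v i : centered_normal_law P (noise_comb v i) (noise_var grp gam v).
Proof.
case: model => _ _ _ _ lawE; have := lawE i v.
congr (centered_normal_law P _ _); apply: eq_bigr => a _.
rewrite (bigD1 a) //= big1 => [|b ba]; rewrite mxE; first by rewrite eqxx; ring.
by rewrite eq_sym (negbTE ba) mulr0.
Qed.

Let mcomb v : measurable_fun setT (fun w => \sum_i noise_comb v i w ^+ 2).
Proof.
apply: measurable_sum => i; apply: measurable_funX.
exact: (group_measurableT mY (@rowE v i)).
Qed.

Let noise_var_eq0 v : noise_var grp gam v = 0 ->
  forall w, \sum_i noise_comb v i w ^+ 2 = 0.
Proof.
move=> /eqP; rewrite psumr_eq0 => [|a _]; last by rewrite mulr_ge0 ?sqr_ge0 // ltW.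
move=> /allP v0 w; rewrite big1 // => i _; rewrite /noise_comb big1 ?expr0n // => a _.
have := v0 a (mem_index_enum _); rewrite /= mulf_eq0 gt_eqF //= sqrf_eq0.
by move=> /eqP ->; rewrite mul0r.
Qed.

Let noise_var_ge0 v : 0 <= noise_var grp gam v.
Proof. by apply: sumr_ge0 => a _; rewrite mulr_ge0 ?sqr_ge0 // ltW. Qed.

(** Strict inequalities for the noise, large ones for signal and cross terms: the zero vector is an
    integer point, and a probe can vanish for a singleton group. The variance is then 0 and the
    event has to be empty. *)
Definition bad_noise_upper (y : R) v :=
  [set w | n%:R * noise_var grp gam v * (1 + rate y) < \sum_i noise_comb v i w ^+ 2].
Definition bad_noise_lower (y : R) v :=
  [set w | \sum_i noise_comb v i w ^+ 2 < n%:R * noise_var grp gam v * (1 - rate y)].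
Definition bad_signal (y : R) (jk : 'I_K * 'I_K) :=
  [set w | \sum_i signal_diff jk.1 jk.2 i w ^+ 2 <=
    n%:R * signal_gap C jk.1 jk.2 * (1 - rate y)].
Definition bad_cross (y : R) (jb : 'I_K * 'I_p) :=
  [set w | n%:R * Num.sqrt (signal_gap C jb.1 (grp jb.2) * gam (grp jb.2)) * rate y <=
    \sum_i signal_diff jb.1 (grp jb.2) i w * E i jb.2 w].

Lemma bad_noise_upper_measurable y v : measurable (bad_noise_upper y v).
Proof. exact: measurable_gt_set. Qed.

Lemma bad_noise_lower_measurable y v : measurable (bad_noise_lower y v).
Proof. exact: measurable_lt_set. Qed.

Lemma prob_bad_noise_upper y v : 0 <= y ->
  (P (bad_noise_upper y v) <= (expR (- (n%:R * y)))%:E)%E.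
Proof.
move=> y0; have [s0|s0] := eqVneq (noise_var grp gam v) 0.
  rewrite [X in P X](_ : _ = set0) ?measure0 ?lee_fin ?expR_ge0 //.
  apply/seteqP; split => w //; rewrite /bad_noise_upper /bad_noise_lower /=.
  by rewrite (noise_var_eq0 s0) s0 mulr0 mul0r ltxx.
have sp : 0 < noise_var grp gam v by rewrite lt_neqAle eq_sym s0 noise_var_ge0.
apply: le_trans (gaussian_square_sum_upper mY iY sp y0 (@rowE v) (lawE v)).
apply: le_measure; rewrite ?inE; [exact: bad_noise_upper_measurable| |].
  exact: measurable_ge_set.
by move=> w /= /ltW.
Qed.

Lemma prob_bad_noise_lower y v : 0 <= y ->
  (P (bad_noise_lower y v) <= (expR (- (n%:R * y)))%:E)%E.
Proof.
move=> y0; have [s0|s0] := eqVneq (noise_var grp gam v) 0.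
  rewrite [X in P X](_ : _ = set0) ?measure0 ?lee_fin ?expR_ge0 //.
  apply/seteqP; split => w //; rewrite /bad_noise_upper /bad_noise_lower /=.
  by rewrite (noise_var_eq0 s0) s0 mulr0 mul0r ltxx.
have sp : 0 < noise_var grp gam v by rewrite lt_neqAle eq_sym s0 noise_var_ge0.
apply: le_trans (gaussian_square_sum_lower mY iY sp y0 (@rowE v) (lawE v)).
apply: le_measure; rewrite ?inE; [exact: bad_noise_lower_measurable| |].
  exact: measurable_le_set.
by move=> w /= /ltW.
Qed.

Lemma bad_signal_measurable y jk : measurable (bad_signal y jk).
Proof.
apply: measurable_le_set; apply: measurable_sum => i; apply: measurable_funX.
exact: (group_measurableT mY (@rowZ _ _ i)).
Qed.

Lemma prob_bad_signal y jk : 0 <= y -> 0 < signal_gap C jk.1 jk.2 ->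
  (P (bad_signal y jk) <= (expR (- (n%:R * y)))%:E)%E.
Proof.
by move=> y0 s0; exact: (gaussian_square_sum_lower mY iY s0 y0 (@rowZ _ _) (lawZ _ _)).
Qed.

Let unit_combE b i w : noise_comb (unit_vector b) i w = E i b w.
Proof.
rewrite /noise_comb (bigD1 b) //= /unit_vector eqxx mul1r big1 ?addr0 //.
by move=> a /negbTE ->; rewrite mul0r.
Qed.

Lemma bad_cross_measurable y jb : measurable (bad_cross y jb).
Proof.
apply: measurable_ge_set; apply: measurable_sum => i; apply: measurable_funM.
  exact: (group_measurableT mY (@rowZ _ _ i)).
by case: model => _ mE _ _ _; exact: mE.
Qed.

Lemma prob_bad_cross y jb : 0 <= y -> 0 < signal_gap C jb.1 (grp jb.2) ->
  (P (bad_cross y jb) <= (expR (- (n%:R * y)))%:E)%E.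
Proof.
move=> y0 s0; set b := jb.2.
have vE : noise_var grp gam (unit_vector b) = gam (grp b).
  rewrite /noise_var (bigD1 b) //= /unit_vector eqxx expr1n mulr1 big1 ?addr0 //.
  by move=> a /negbTE ->; rewrite expr0n mulr0.
have lawb i : centered_normal_law P (noise_comb (unit_vector b) i) (gam (grp b)).
  by rewrite -vE; exact: lawE.
have := gaussian_product_sum_upper mY iY s0 (gam0 (grp b)) y0 (@rowZ _ _)
  (@rowE (unit_vector b)) (lawZ _ _) lawb (fun i => @ZE_indep _ _ (unit_vector b) i).
congr (P _ <= _)%E; apply/seteqP; split => w /=.
  by under eq_bigr do rewrite unit_combE.
by under [X in _ -> _ <= X]eq_bigr do rewrite unit_combE.
Qed.

End Model.

(** * Union bound and conclusion *)

Section Assembly.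
Context {R : realType}.

Lemma min_group_size_le p K (grp : 'I_p -> 'I_K) k :
  (min_group_size grp <= group_size grp k)%N.
Proof.
rewrite /min_group_size; have := mem_index_enum k.
elim: (index_enum _) => //= l s IH; rewrite inE big_cons geq_min.
by case: eqP => [->|_ /IH ->]; rewrite ?leqnn ?orbT.
Qed.

Lemma min_group_size_gt0 p K (grp : 'I_p -> 'I_K) : (0 < p)%N ->
  (forall k : 'I_K, exists a : 'I_p, grp a = k) -> (0 < min_group_size grp)%N.
Proof.
move=> p0 surj; rewrite /min_group_size.
apply: (big_ind (fun x => 0 < x)%N) => // [x y x0 y0|k _].
  by rewrite leq_min x0 y0.
by have [a <-] := surj k; exact: group_size_gt0.
Qed.

Lemma supnorm_ge p q (A : 'M[R]_(p, q)) i j : `|A i j| <= supnorm A.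
Proof.
rewrite /supnorm; apply: le_trans (le_bigmax _ _ i) => /=.
exact: (@le_bigmax _ _ _ 0 (fun j => `|A i j|) j).
Qed.

Lemma varnorm_le p (D : 'M[R]_p) (x : R) : 0 <= x ->
  (varnorm D <= x) <-> (forall a b, D a a - D b b <= x).
Proof.
move=> x0; split => [h a b|h]; first exact: le_trans (varnorm_ge D a b) h.
by apply: bigmax_le => // a _; apply: bigmax_le => // b _.
Qed.

Lemma surj_leq p K (grp : 'I_p -> 'I_K) :
  (forall k : 'I_K, exists a : 'I_p, grp a = k) -> (K <= p)%N.
Proof.
move=> /choice[f hf].
have inj : injective f by exact: can_inj hf.
by have := leq_card f inj; rewrite !card_ord.
Qed.

Lemma expRN_3ln (n p : nat) : (0 < n)%N -> (0 < p)%N ->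
  expR (- (n%:R * (3 * ln p%:R / n%:R))) = p%:R ^- 3 :> R.
Proof.
move=> n0 p0; have -> : n%:R * (3 * ln p%:R / n%:R) = 3%:R * ln (p%:R : R).
  by field; rewrite pnatr_eq0 -lt0n.
by rewrite expRN expRM_natl lnK // posrE ltr0n.
Qed.

Lemma expRN_8 (n p : nat) : (0 < n)%N ->
  expR (- (n%:R * (8 * p%:R / n%:R))) <= (4 ^+ p * 64 ^+ p)^-1 :> R.
Proof.
move=> n0; have -> : n%:R * (8 * p%:R / n%:R) = (8 * p)%:R * 1 :> R.
  by rewrite natrM mulr1; field; rewrite pnatr_eq0 -lt0n.
rewrite expRN expRM_natl lef_pV2 ?posrE ?exprn_gt0 ?expR_gt0 ?mulr_gt0 ?exprn_gt0 //.
have -> : 4 ^+ p * 64 ^+ p = 2 ^+ (8 * p) :> R.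
  by rewrite exprM -exprMn; congr (_ ^+ _); lra.
by rewrite lerXn2r ?nnegrE ?expR_ge0 //; have := @expR_ge1Dx R 1; lra.
Qed.

Lemma natr_le_exp4 p : p%:R <= 4 ^+ p :> R.
Proof. by rewrite -natrX ler_nat ltnW // ltn_expl. Qed.

Lemma pairs_rate (p N : nat) : (0 < p)%N -> (N <= p * p)%N ->
  N%:R * p%:R ^- 3 <= p%:R^-1 :> R.
Proof.
move=> p0 hN; have p0' : 0 < p%:R :> R by rewrite ltr0n.
rewrite ler_pdivrMr ?exprn_gt0 // exprS mulrA mulVf ?gt_eqF // mul1r.
by rewrite expr2 -natrM ler_nat.
Qed.

Section Probability.
Context d (T : measurableType d) (P : probability T R).
Variables (n p K : nat) (grp : 'I_p -> 'I_K) (C : 'M[R]_K) (gam : 'I_K -> R).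
Variables (Z : 'I_n -> 'I_K -> T -> R) (E : 'I_n -> 'I_p -> T -> R).
Variables (G : T -> 'M[R]_p) (delta : R).
Hypothesis n0 : (0 < n)%N.
Hypothesis p0 : (0 < p)%N.
Hypothesis surj : forall k : 'I_K, exists a : 'I_p, grp a = k.
Hypothesis Csym : C^T = C.
Hypothesis gam0 : forall k, 0 < gam k.
Hypothesis model : GLatentModel P grp C gam Z E.
Hypothesis gap0 : forall j k, j != k -> 0 < signal_gap C j k.
Hypothesis mG : forall a b, measurable_fun setT (fun w => G w a b).
Hypothesis delta0 : 0 <= delta.

(** At level [y1] an event costs p^(-3), against at most 2 p^2 events in a family. At level [y2] it
    costs exp (- 8 p) <= 2^(-8p), the inverse of 4^p 64^p: the factor 64^p pays for the integer
    points, and 4^p >= p leaves 1 / p. *)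
Let y1 : R := 3 * ln p%:R / n%:R.
Let y2 : R := 8 * p%:R / n%:R.

Let y10 : 0 <= y1.
Proof. by rewrite !mulr_ge0 ?invr_ge0 // ln_ge0 // ler1n. Qed.
Let y20 : 0 <= y2. Proof. by rewrite !mulr_ge0 ?invr_ge0. Qed.
Let pR0 : 0 < p%:R :> R. Proof. by rewrite ltr0n. Qed.

Let good_G := [set w | varnorm (G w - Gamma_of grp gam) <= delta].

Let good_G_measurable : measurable good_G.
Proof.
rewrite (_ : good_G = \bigcap_(ab in [set: 'I_p * 'I_p])
    [set w | G w ab.1 ab.1 - G w ab.2 ab.2 <=
       delta + (gam (grp ab.1) - gam (grp ab.2))]).
  apply: fin_bigcap_measurable => [|ab _]; first exact: finite_finset.
  by apply: measurable_le_set; exact: measurable_funB.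
have DE w a b : ((G w - Gamma_of grp gam) a a - (G w - Gamma_of grp gam) b b <= delta)
    = (G w a a - G w b b <= delta + (gam (grp a) - gam (grp b))).
  rewrite !mxE !eqxx; apply/idP/idP => h; lra.
apply/seteqP; split => w /=.
  by move=> /(varnorm_le _ delta0) h [a b] _ /=; rewrite -DE.
by move=> h; apply/(varnorm_le _ delta0) => a b; rewrite DE; exact: (h (a, b)).
Qed.

Let bad_all : set T :=
  bad_union [pred jk : 'I_K * 'I_K | jk.1 != jk.2] (bad_signal C Z y1) `|`
  (bad_union [pred jb : 'I_K * 'I_p | jb.1 != grp jb.2] (bad_cross grp C gam Z E y1) `|`
  (bad_union predT (fun x : 'I_p * 'I_p * bool =>
     bad_noise_upper grp gam E y1 (probe grp x.1.1 x.1.2 x.2)) `|`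
  (bad_union predT (fun x : 'I_p * 'I_p * bool =>
     bad_noise_lower grp gam E y1 (probe grp x.1.1 x.1.2 x.2)) `|`
  (bad_union (@lattice_ball p) (fun f =>
     bad_noise_upper grp gam E y2 (fun a => (lattice_point f a)%:~R)) `|`
  bad_union predT (fun a : 'I_p =>
     bad_noise_lower grp gam E y2 (unit_vector a)))))).

Let mU v y : measurable (bad_noise_upper grp gam E y v).
Proof. exact: bad_noise_upper_measurable model _ _. Qed.
Let mL v y : measurable (bad_noise_lower grp gam E y v).
Proof. exact: bad_noise_lower_measurable model _ _. Qed.
Let mS jk y : measurable (bad_signal C Z y jk).
Proof. exact: bad_signal_measurable model _ _. Qed.
Let mC jb y : measurable (bad_cross grp C gam Z E y jb).
Proof. exact: bad_cross_measurable model _ _. Qed.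

Let bad_all_measurable : measurable bad_all.
Proof. by do 5 (apply: measurableU; first exact: bad_union_measurable);
  exact: bad_union_measurable. Qed.

Let prob_bad_all : (P bad_all <= (8 / p%:R)%:E)%E.
Proof.
have Kp : (K <= p)%N by exact: surj_leq surj.
have U2 (A B : set T) (x y : R) : measurable A -> measurable B ->
    (P A <= x%:E)%E -> (P B <= y%:E)%E -> (P (A `|` B) <= (x + y)%:E)%E.
  move=> mA mB hA hB; apply: le_trans (measureU2 _ mA mB) _.
  by rewrite EFinD; exact: leeD.
(* One summand per family; the two probe families count twice because of the sign. *)
have -> : 8 / p%:R = p%:R^-1 + (p%:R^-1 + (2 * p%:R^-1 + (2 * p%:R^-1 + (p%:R^-1 + p%:R^-1)))) :> R.
  by field; rewrite gt_eqF.
have q1 := expRN_3ln n0 p0; have q2 := @expRN_8 n p n0.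
have sm (N : nat) : N%:R <= 64 ^+ p :> R -> N%:R * (4 ^+ p * 64 ^+ p)^-1 <= p%:R^-1 :> R.
  move=> hN; rewrite invfM mulrCA.
  apply: (@le_trans _ _ ((4 ^+ p)^-1 * 1)).
    rewrite ler_wpM2l ?invr_ge0 ?exprn_ge0 // ler_pdivrMr ?exprn_gt0 //.
    by rewrite mul1r.
  by rewrite mulr1 lef_pV2 ?posrE ?exprn_gt0 // natr_le_exp4.
have e1 (X : finType) (Q : pred X) : (#|Q| <= p * p)%N ->
   #|Q|%:R * expR (- (n%:R * y1)) <= p%:R^-1 :> R.
  by move=> h; rewrite q1 pairs_rate.
have e3 : #|(predT : pred ('I_p * 'I_p * bool))|%:R * expR (- (n%:R * y1)) <= 2 * p%:R^-1 :> R.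
  rewrite q1 cardT -cardE !card_prod !card_ord card_bool natrM.
  by have := pairs_rate p0 (leqnn (p * p)); lra.
apply: (@U2 _ _ _ _); [exact: bad_union_measurable
  |by do ?(apply: measurableU; first exact: bad_union_measurable);
    exact: bad_union_measurable| |apply: (@U2 _ _ _ _); [exact: bad_union_measurable
  |by do ?(apply: measurableU; first exact: bad_union_measurable);
    exact: bad_union_measurable| |apply: (@U2 _ _ _ _); [exact: bad_union_measurable
  |by do ?(apply: measurableU; first exact: bad_union_measurable);
    exact: bad_union_measurable| |apply: (@U2 _ _ _ _); [exact: bad_union_measurable
  |by do ?(apply: measurableU; first exact: bad_union_measurable);
    exact: bad_union_measurable| |apply: (@U2 _ _ _ _); [exact: bad_union_measurable|exact: bad_union_measurable| |]]]]].
- apply: (prob_bad_union (q := expR (- (n%:R * y1)))) => // [jk jk0|].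
    exact: (prob_bad_signal Csym model y10 (gap0 jk0)).
  apply: e1; apply: leq_trans (max_card _) _.
  by rewrite card_prod !card_ord leq_mul.
- apply: (prob_bad_union (q := expR (- (n%:R * y1)))) => // [jb jb0|].
    exact: (prob_bad_cross Csym gam0 model y10 (gap0 jb0)).
  apply: e1; apply: leq_trans (max_card _) _.
  by rewrite card_prod !card_ord leq_mul.
- apply: (prob_bad_union (q := expR (- (n%:R * y1)))) => // x _.
  exact: (prob_bad_noise_upper gam0 model).
- apply: (prob_bad_union (q := expR (- (n%:R * y1)))) => // x _.
  exact: (prob_bad_noise_lower gam0 model).
- apply: (prob_bad_union (q := expR (- (n%:R * y2)))) => // [f _|].
    exact: (prob_bad_noise_upper gam0 model).
  apply: le_trans (sm _ (card_lattice_ball p)).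
  by rewrite ler_wpM2l.
- apply: (prob_bad_union (q := expR (- (n%:R * y2)))) => // [a _|].
    exact: (prob_bad_noise_lower gam0 model).
  apply: le_trans (sm p _); first by rewrite cardT -cardE card_ord ler_wpM2l.
  by apply: le_trans (natr_le_exp4 p) _; apply: lerXn2r; rewrite ?nnegrE //; lra.
Qed.

(** The estimator is computed from the same data as the Gaussian events, so the two failure
    probabilities are simply added. *)
Lemma exists_good_event (q : R) :
  ((1 - q)%:E <= P [set w | (varnorm (G w - Gamma_of grp gam) <= delta)%R])%E ->
  exists A : set T, [/\ measurable A,
    ((1 - (q + 8 / p%:R))%:E <= P A)%E &
    forall w, A w -> good_event grp C gam (G w)
      (fun i k => Z i k w) (fun i a => E i a w) delta (rate y1) (rate y2)].
Proof.
move=> hq; exists (good_G `\` bad_all); split; first exact: measurableD.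
  have : (P good_G <= P (good_G `\` bad_all) + P bad_all)%E.
    apply: le_trans (measureU2 _ (measurableD good_G_measurable bad_all_measurable)
      bad_all_measurable).
    apply: le_measure; rewrite ?inE //; last first.
      by move=> w Gw; case: (pselect (bad_all w)) => Bw; [right|left].
    by apply: measurableU => //; exact: measurableD.
  move=> h; have := le_trans hq h => {h} h.
  have mD : measurable (good_G `\` bad_all) by exact: measurableD.
  have := le_trans h (leeD2l _ prob_bad_all).
  rewrite -[P (good_G `\` _)]fineK ?fin_num_measure // -EFinD !lee_fin.
  by lra.
move=> w [Gw nbad].
have nb1 : ~ bad_union [pred jk : 'I_K * 'I_K | jk.1 != jk.2] (bad_signal C Z y1) w.
  by move=> h; apply: nbad; left.
have {}nbad2 := fun h => nbad (or_intror h).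
have nb2 := fun h => nbad2 (or_introl h).
have nbad3 := fun h => nbad2 (or_intror h).
have nb3 := fun h => nbad3 (or_introl h).
have nbad4 := fun h => nbad3 (or_intror h).
have nb4 := fun h => nbad4 (or_introl h).
have nbad5 := fun h => nbad4 (or_intror h).
have nb5 := fun h => nbad5 (or_introl h).
have nb6 := fun h => nbad5 (or_intror h).
split.
- exact: Gw.
- move=> j k jk; have := notin_bad_union nb1 (x := (j, k)) jk.
  by move=> /negP; rewrite -ltNge => /ltW.
- move=> j b jb; have := notin_bad_union nb2 (x := (j, b)) jb.
  by move=> /negP; rewrite -ltNge => /ltW.
- move=> a b s; have := notin_bad_union nb4 (x := (a, b, s)) isT.
  by move=> /negP; rewrite -leNgt.
- move=> a b s; have := notin_bad_union nb3 (x := (a, b, s)) isT.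
  by move=> /negP; rewrite -leNgt.
- move=> f fb; have := notin_bad_union nb5 (x := f) fb.
  by move=> /negP; rewrite -leNgt.
- move=> a; have := notin_bad_union nb6 (x := a) isT.
  by move=> /negP; rewrite -leNgt.
Qed.

End Probability.
End Assembly.

Lemma ratr_inv_nat (R : realType) (n : nat) : ratr (n%:R^-1) = n%:R^-1 :> R.
Proof. by rewrite fmorphV /= ratr_nat. Qed.

Lemma ratr_mul_nat (R : realType) (m n : nat) :
  ratr (m%:R * n%:R) = m%:R * n%:R :> R.
Proof. by rewrite rmorphM /= !ratr_nat. Qed.

Theorem mainTheorem8 :
  exists c1 c2 c3 : rat, [/\ 0 < c1, 0 < c2, 0 < c3 &
  forall (R : realType) (d : measure_display) (T : measurableType d)
    (P : probability T R) (n p K : nat)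
    (grp : 'I_p -> 'I_K) (C : 'M[R]_K) (gam : 'I_K -> R)
    (Z : 'I_n -> 'I_K -> T -> R) (E : 'I_n -> 'I_p -> T -> R)
    (Ghat : 'M[R]_(n, p) -> 'M[R]_p) (delta : R),
    (0 < n)%N -> (0 < K)%N ->
    (forall k : 'I_K, exists a : 'I_p, grp a = k) ->
    C^T = C -> psd C ->
    (forall k, 0 < gam k) ->
    GLatentModel P grp C gam Z E ->
    (forall x, is_diag_mx (Ghat x)) ->
    (forall a b : 'I_p,
        measurable_fun setT (fun w => Ghat (Xdata grp Z E w) a b)) ->
    0 <= delta ->
    ((1 - ratr c3 / (2 * p%:R))%:E <=
       P [set w | (varnorm (Ghat (Xdata grp Z E w) - Gamma_of grp gam) <= delta)%R])%E ->
    ln (p%:R : R) <= ratr c1 * n%:R ->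
    (let m := (min_group_size grp)%:R in
     forall j k : 'I_K, (j < k)%N ->
       ratr c2 * (supnorm (Gamma_of grp gam) *
               (Num.sqrt (ln (p%:R : R) / (m * n%:R)) + Num.sqrt (p%:R / (n%:R * m ^+ 2))
                + ln (p%:R : R) / n%:R + p%:R / (n%:R * m))
             + delta / m)
       <= C j j + C k k - 2 * C j k) ->
    exists A : set T, [/\ measurable A,
      ((1 - ratr c3 / p%:R)%:E <= P A)%E &
      A `<=` [set w | unique_maximizer K
                 (Sigmahat (Xdata grp Z E w) - Ghat (Xdata grp Z E w))
                 (Bstar grp)]]].
Proof.
(* c3 = 16: the estimator fails with probability at most c3 / (2 p) = 8 / p, and the Gaussian events
   cost another 8 / p. The other two constants are those of [signal_threshold]. *)
exists 1000^-1, (200 * 200), 16.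
split; [by rewrite invr_gt0 ltr0n|by rewrite mulr_gt0 ?ltr0n|by rewrite ltr0n|].
move=> R d T P n p K grp C gam Z E Ghat delta n0 K0 surj Csym _ gam0 model
  diagG mG delta0.
rewrite (ratr_inv_nat R 1000) (ratr_mul_nat R 200 200) (ratr_nat R 16).
set m : R := (min_group_size grp)%:R; set S := supnorm _.
move=> hG hL hgap.
have [a0 _] := surj (Ordinal K0).
have p0 : (0 < p)%N by exact: leq_ltn_trans (leq0n _) (ltn_ord a0).
have nR0 : 0 < n%:R :> R by rewrite ltr0n.
have pR0 : 0 < p%:R :> R by rewrite ltr0n.
have m1 : 1 <= m by rewrite ler1n min_group_size_gt0.
have m0 : 0 < m by exact: lt_le_trans ltr01 m1.
have hm k : m <= (group_size grp k)%:R by rewrite ler_nat min_group_size_le.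
have gamS k : gam k <= S.
  have [a <-] := surj k.
  have := supnorm_ge (Gamma_of grp gam) a a; rewrite mxE eqxx.
  exact: le_trans (ler_norm _).
have S0 : 0 < S by exact: lt_le_trans (gam0 (grp a0)) (gamS _).
have L0 : 0 <= ln (p%:R : R) by rewrite ln_ge0 // ler1n.
have tgap j k : j != k -> 200 * 200 * threshold n%:R p%:R m S delta (ln p%:R) <= signal_gap C j k.
  have Cjk a b : C a b = C b a by rewrite -{1}Csym mxE.
  move=> jk; case: (ltngtP j k) => [jk'|kj|/val_inj jk']; first exact: hgap.
    have -> : signal_gap C j k = signal_gap C k j by rewrite /signal_gap (Cjk j k); ring.
    exact: hgap.
  by rewrite jk' eqxx in jk.
(* The term S p / (n m) is positive, which makes every signal gap positive: the tail bounds ask for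
   nondegenerate variances. *)
have t0 : 0 < threshold n%:R p%:R m S delta (ln p%:R).
  have b0 : 0 < p%:R / (n%:R * m) by apply: divr_gt0 => //; exact: mulr_gt0.
  have l0 : 0 <= ln p%:R / n%:R :> R by apply: divr_ge0 => //; exact: ltW.
  rewrite /threshold; apply: ltr_wpDr; first by apply: divr_ge0 => //; exact: ltW.
  by apply: mulr_gt0 => //; apply: ltr_wpDl b0; rewrite !addr_ge0 ?sqrtr_ge0.
have gap0 j k : j != k -> 0 < signal_gap C j k.
  by move=> jk; apply: lt_le_trans (tgap _ _ jk); rewrite !mulr_gt0.
have [A [mA PA hA]] := exists_good_event n0 p0 surj Csym gam0 model gap0 mG delta0 hG.
exists A; split => //.
  apply: le_trans PA; rewrite lee_fin le_eqVlt; apply/orP; left; apply/eqP.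
  by field; rewrite gt_eqF.
move=> w /hA good.
apply: (good_event_maximizer surj n0 p0 (ltW S0) gamS _ _ delta0 m1 hm (diagG _) good).
- by apply: rate_ge0; rewrite !mulr_ge0 ?invr_ge0.
- by apply: rate_ge0; rewrite !mulr_ge0 ?invr_ge0.
- move=> j b jb; apply: signal_threshold => //.
  + exact: ltW.
  + exact: gap0.
  + exact: ltW.
  + exact: tgap.
Qed.
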